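(* Let $\sigma>0$, $\alpha>0$, and let $F:\mathcal{P}(\mathcal{X})\times\mathcal{P}(\mathcal{Y})\to\mathbb{R}$ admit first and second order flat derivatives such that: (i) there exist $C_\nu,C_\mu>0$ with $\left|\frac{\delta F}{\delta\nu}(\nu,\mu,x)\right|\le C_\nu$ and $\left|\frac{\delta F}{\delta\mu}(\nu,\mu,y)\right|\le C_\mu$ for all $(\nu,\mu)\in\mathcal{P}(\mathcal{X})\times\mathcal{P}(\mathcal{Y})$ and $(x,y)\in\mathcal{X}\times\mathcal{Y}$; (ii) there exist $C_{\nu,\nu},C_{\mu,\mu},C_{\nu,\mu},C_{\mu,\nu}>0$ with $\left|\frac{\delta^2F}{\delta\nu^2}(\nu,\mu,x,x')\right|\le C_{\nu,\nu}$, $\left|\frac{\delta^2F}{\delta\mu^2}(\nu,\mu,y,y')\right|\le C_{\mu,\mu}$, $\left|\frac{\delta^2F}{\delta\nu\delta\mu}(\nu,\mu,y,x)\right|\le C_{\nu,\mu}$, $\left|\frac{\delta^2F}{\delta\mu\delta\nu}(\nu,\mu,x,y)\right|\le C_{\mu,\nu}$ for all $(\nu,\mu)\in\mathcal{P}(\mathcal{X})\times\mathcal{P}(\mathcal{Y})$ and $(x,y),(x',y')\in\mathcal{X}\times\mathcal{Y}$. Let $(\nu_0,\mu_0)\in\mathcal{P}_{\mathrm{ac}}(\mathcal{X})\times\mathcal{P}_{\mathrm{ac}}(\mathcal{Y})$. Then there exists a unique pair of flows $(\nu_t,\mu_t)_{t\ge0}$ in $(\mathcal{P}_{\mathrm{ac}}(\mathcal{X})\times\mathcal{P}_{\mathrm{ac}}(\mathcal{Y}),\operatorname{TV})$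 with initial condition $(\nu_0,\mu_0)$ satisfying the mean-field best response (MF-BR) system $$\mathrm{d}\nu_t(x)=\alpha\left(\Psi_\sigma(\nu_t,\mu_t)(x)-\nu_t(x)\right)\mathrm{d}t,\qquad\mathrm{d}\mu_t(y)=\alpha\left(\Phi_\sigma(\nu_t,\mu_t)(y)-\mu_t(y)\right)\mathrm{d}t,\qquad t\ge0.$$ Moreover, the solutions depend continuously on the initial conditions, and $t\mapsto\nu_t$ belongs to $C^1([0,\infty),\mathcal{P}_{\mathrm{ac}}(\mathcal{X}))$ and $t\mapsto\mu_t$ belongs to $C^1([0,\infty),\mathcal{P}_{\mathrm{ac}}(\mathcal{Y}))$.
   Context: Setting. $\mathcal{X},\mathcal{Y}\subseteq\mathbb{R}^d$; $U^\pi:\mathcal{X}\to\mathbb{R}$ and $U^\rho:\mathcal{Y}\to\mathbb{R}$ are measurable with $\int_{\mathcal{X}}e^{-U^\pi(x)}\mathrm{d}x=\int_{\mathcal{Y}}e^{-U^\rho(y)}\mathrm{d}y=1$. $\mathcal{P}(\mathcal{Z})$ is the set of probability measures on $\mathcal{Z}$ and $\mathcal{P}_{\mathrm{ac}}(\mathcal{Z})$ the subset of those absolutely continuous with respect to Lebesgue measure; a measure and its density are denoted by the same symbol. $\operatorname{TV}(P,Q)=\sup_A|P(A)-Q(A)|$ is the total variation distance (so $\operatorname{TV}(m,m')=\frac12\int|m(x)-m'(x)|\mathrm{d}x$ for densities). Flat derivatives. For $\mathcal{M}\subseteq\mathbb{R}^d$, $G:\mathcal{P}(\mathcal{M})\to\mathbb{R}$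 admits a first order flat derivative if there is $\frac{\delta G}{\delta m}:\mathcal{P}(\mathcal{M})\times\mathcal{M}\to\mathbb{R}$, jointly continuous (weak topology on $\mathcal{P}(\mathcal{M})$), such that for each $m$ the function $\frac{\delta G}{\delta m}(m,\cdot)$ is bounded and, for all $m,m'$, $G(m')-G(m)=\int_0^1\int_{\mathcal{M}}\frac{\delta G}{\delta m}(m+\varepsilon(m'-m),x)(m'-m)(\mathrm{d}x)\mathrm{d}\varepsilon$; it is normalized by $\int_{\mathcal{M}}\frac{\delta G}{\delta m}(m,x)m(\mathrm{d}x)=0$. For $F$ on $\mathcal{P}(\mathcal{X})\times\mathcal{P}(\mathcal{Y})$, $\frac{\delta F}{\delta\nu}(\nu,\mu,x)$ and $\frac{\delta F}{\delta\mu}(\nu,\mu,y)$ are the flat derivatives in the first and second argument. Second order flat derivatives are flat derivatives of first order ones with the point fixed: $\frac{\delta^2F}{\delta\nu^2}(\nu,\mu,x,\cdot)$ and $\frac{\delta^2F}{\delta\mu\delta\nu}(\nu,\mu,x,\cdot)$ are the flat derivatives in $\nu$, resp. $\mu$, of $\frac{\delta F}{\delta\nu}(\nu,\mu,x)$; $\frac{\delta^2F}{\delta\mu^2}(\nu,\mu,y,\cdot)$ and $\frac{\delta^2F}{\delta\nu\delta\mu}(\nu,\mu,y,\cdot)$ are those in $\mu$, resp. $\nu$, of $\frac{\delta F}{\delta\mu}(\nu,\mu,y)$. Best responses. $\Psi_\sigma(\nu,\mu)$ and $\Phi_\sigma(\nu,\mu)$ are the probability measures on $\mathcal{X}$, $\mathcal{Y}$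 with densities $$\Psi_\sigma(\nu,\mu)(x)=\tfrac{1}{Z(\nu,\mu)}\exp\left(-\tfrac{2}{\sigma^2}\tfrac{\delta F}{\delta\nu}(\nu,\mu,x)-U^\pi(x)\right),\quad\Phi_\sigma(\nu,\mu)(y)=\tfrac{1}{Z'(\nu,\mu)}\exp\left(\tfrac{2}{\sigma^2}\tfrac{\delta F}{\delta\mu}(\nu,\mu,y)-U^\rho(y)\right),$$ where $Z,Z'$ are normalizing constants. *)

(* Defs.v *)
From HB Require Import structures.
From mathcomp Require Import all_boot all_order all_algebra.
From mathcomp Require Import all_classical all_reals all_analysis.
From mathcomp Require Import measurable_realfun.

Set Implicit Arguments.
Unset Strict Implicit.
Unset Printing Implicit Defensive.
Import Order.TTheory GRing.Theory Num.Theory.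
Import numFieldNormedType.Exports.

Local Open Scope classical_set_scope.
Local Open Scope ring_scope.

(* R^d is 'rV[R]_d with its product topology and Borel sigma-algebra. *)
Section borel_rV.
Context (R : realType) (d : nat).

Definition rV_borel : set (set 'rV[R]_d) := <<s @open 'rV[R]_d >>.

Let rV_borel0 : rV_borel set0. Proof. exact: sigma_algebra0. Qed.

Let rV_borelC A : rV_borel A -> rV_borel (~` A).
Proof. exact: sigma_algebraC. Qed.

Let rV_borelU (F : (set 'rV[R]_d)^nat) :
  (forall i, rV_borel (F i)) -> rV_borel (\bigcup_i F i).
Proof. exact: sigma_algebra_bigcup. Qed.

HB.instance Definition _ := @isMeasurable.Build (sigma_display (@open 'rV[R]_d))
  'rV[R]_d rV_borel rV_borel0 rV_borelC rV_borelU.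

End borel_rV.

Section measurable_rV.
Context (R : realType) (n : nat).

Lemma measurable_coord (i : 'I_n) :
  measurable_fun [set: 'rV[R]_n] (fun v : 'rV[R]_n => v ord0 i).
Proof.
apply: (@measurability _ _ _ _ _ _ _ (RGenOpens.measurableE R)).
move=> _ [_ [a [b ->]] <-]; rewrite setTI.
apply: sub_sigma_algebra.
apply: open_comp; last exact: interval_open.
by move=> x _; exact: coord_continuous.
Qed.

Lemma measurable_fun_rV d0 (T : measurableType d0) (f : T -> 'rV[R]_n) :
  (forall i, measurable_fun [set: T] (fun t => f t ord0 i)) ->
  measurable_fun [set: T] f.
Proof.
move=> mf; apply: (@measurability _ _ _ _ _ f (@open 'rV[R]_n)) => //.
move=> _ [U oU <-]; rewrite setTI.
pose q_ (q : 'rV[rat]_n) : 'rV[R]_n := \row_i ratr (q ord0 i).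
pose P (qk : 'rV[rat]_n * nat) : set 'rV[R]_n :=
  if `[< ball (q_ qk.1) (qk.2.+1%:R^-1) `<=` U >]
  then ball (q_ qk.1) (qk.2.+1%:R^-1) else set0.
have -> : U = \bigcup_qk P qk.
  apply/seteqP; split => [v Uv|v [qk _]]; last first.
    by rewrite /P; case: asboolP => // + Pv; exact.
  have /nbhs_ballP[e /= e0 veU] : nbhs v U by apply: open_nbhs_nbhs; split.
  have [k] := near_infty_natSinv_lt (PosNum (divr_gt0 e0 (ltr0n _ 2))).
  move=> _ /(_ k (leqnn _))/= ke.
  have k0 : 0 < k.+1%:R^-1 :> R by rewrite invr_gt0 ltr0n.
  have qP i : exists q : rat, `|ratr q - v ord0 i| < k.+1%:R^-1.
    have /rat_in_itvoo[q] : v ord0 i - k.+1%:R^-1 < v ord0 i + k.+1%:R^-1.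
      by rewrite ltrD2l (lt_trans _ k0)// oppr_lt0.
    by rewrite in_itv/= => qv; exists q; rewrite ltr_distl.
  pose q : 'rV[rat]_n := \row_i projT1 (cid (qP i)).
  have bqv : ball (q_ q) k.+1%:R^-1 v.
    split => // i j; rewrite ord1 /ball/= !mxE.
    by case: cid.
  exists (q, k) => //; rewrite /P /=; case: asboolP => // nU; exfalso.
  apply: nU => w bqw; apply: veU.
  apply: (@le_ball _ _ _ (k.+1%:R^-1 + k.+1%:R^-1)).
    by rewrite [leRHS]splitr lerD// ltW.
  by apply: ball_triangle bqw; exact: ball_sym.
rewrite preimage_bigcup; apply: countable_bigcupT_measurable => [|[q k]].
  exact: countableP.
rewrite /P /=; case: asboolP => _; last by rewrite preimage_set0.
have k0 : 0 < k.+1%:R^-1 :> R by rewrite invr_gt0 ltr0n.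
rewrite (_ : f @^-1` _ = \bigcap_(i in [set: 'I_n])
    ((fun t => f t ord0 i) @^-1` ball (ratr (q ord0 i) : R) k.+1%:R^-1)).
  apply: fin_bigcap_measurable => // i _; rewrite -[X in measurable X]setTI.
  by apply: mf => //; apply: open_measurable; exact: ball_open.
apply/seteqP; split => [t [_ qf] i _|t qf].
  by have := qf ord0 i; rewrite !mxE.
by split => // i j; rewrite ord1 !mxE; exact: qf.
Qed.

End measurable_rV.

Section lebesgue_rV.
Context (R : realType).

Definition cons_rV n (p : measurableTypeR R * 'rV[R]_n) : 'rV[R]_n.+1 :=
  \row_i (if unlift ord0 i is Some j then p.2 ord0 j else p.1).

Lemma measurable_cons_rV n : measurable_fun [set: _] (@cons_rV n).
Proof.
apply: measurable_fun_rV => i; rewrite /cons_rV.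
case: (unliftP ord0 i) => [j ->|->].
  under eq_fun do rewrite mxE liftK.
  exact: (measurableT_comp (@measurable_coord R n j)).
under eq_fun do rewrite mxE unlift_none.
exact: measurable_fst.
Qed.

HB.instance Definition _ n := isMeasurableFun.Build _ _ _ _ (@cons_rV n)
  (@measurable_cons_rV n).

Section lebesgue_cons.
Local Open Scope ereal_scope.
Context n (m : {sigma_finite_measure set 'rV[R]_n -> \bar R}).

Definition lebesgue_cons : set 'rV[R]_n.+1 -> \bar R :=
  pushforward (lebesgue_measure \x m) (@cons_rV n).

Let lebesgue_cons0 : lebesgue_cons set0 = 0.
Proof. exact: measure0. Qed.

Let lebesgue_cons_ge0 A : 0 <= lebesgue_cons A.
Proof. exact: measure_ge0. Qed.

Let lebesgue_cons_sigma_additive : semi_sigma_additive lebesgue_cons.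
Proof. exact: measure_semi_sigma_additive. Qed.

HB.instance Definition _ := isMeasure.Build _ _ _ lebesgue_cons
  lebesgue_cons0 lebesgue_cons_ge0 lebesgue_cons_sigma_additive.

Let lebesgue_cons_sigma_finite : sigma_finite setT lebesgue_cons.
Proof.
have [F FT mF] : sigma_finite setT (lebesgue_measure \x m).
  have /sigma_finiteP[F [TF ndF Foo]] :=
    sigma_finiteT (@lebesgue_measure R : {sigma_finite_measure set _ -> \bar R}).
  have /sigma_finiteP[G [TG ndG Goo]] := sigma_finiteT m.
  exists (fun k => F k `*` G k) => [|k].
    rewrite -setXTT TF TG; apply/seteqP; split => [[x v]|[x v] [k _ []]].
      move=> [[i _ Fx] [j _ Gv]]; exists (maxn i j) => //; split.
        by have /subsetPset := ndF _ _ (leq_maxl i j); exact.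
      by have /subsetPset := ndG _ _ (leq_maxr i j); exact.
    by split; exists k.
  have [? ?] := Foo k; have [? ?] := Goo k.
  split; first exact: measurableX.
  by rewrite product_measure1E// lte_mul_pinfty// ge0_fin_numE.
pose uncons (v : 'rV[R]_n.+1) : measurableTypeR R * 'rV[R]_n :=
  (v ord0 ord0, \row_j v ord0 (lift ord0 j)).
have muncons : measurable_fun setT uncons.
  apply/measurable_fun_pairP; split; first exact: measurable_coord.
  apply: measurable_fun_rV => i.
  by under eq_fun do rewrite /= mxE; exact: measurable_coord.
have unconsK : cancel (@cons_rV n) uncons.
  move=> [x v]; rewrite /uncons !mxE unlift_none; congr (_, _).
  by apply/rowP => j; rewrite !mxE liftK.
exists (fun k => uncons @^-1` F k) => [|k].
  by rewrite -preimage_bigcup -FT preimage_setT.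
split; first by rewrite -[X in measurable X]setTI; apply: muncons => //; case: (mF k).
rewrite /lebesgue_cons /pushforward (_ : _ @^-1` _ = F k); first by case: (mF k).
by apply/seteqP; split => p; rewrite /preimage/= unconsK.
Qed.

HB.instance Definition _ := Measure_isSigmaFinite.Build _ _ _ lebesgue_cons
  lebesgue_cons_sigma_finite.

End lebesgue_cons.

(* d-fold product of the one-dimensional Lebesgue measure *)
Fixpoint lebesgue_rV d : {sigma_finite_measure set 'rV[R]_d -> \bar R} :=
  if d is n.+1 then lebesgue_cons (lebesgue_rV n) else \d_(0 : 'rV[R]_0).

Lemma lebesgue_rV_box d (a b : 'I_d -> R) : (forall i, a i <= b i) ->
  lebesgue_rV d [set v | forall i, v ord0 i \in `[a i, b i]] =
  (\prod_(i < d) (b i - a i))%:E.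
Proof.
elim: d a b => [|n IH] a b ab /=.
  rewrite big_ord0 diracE mem_set//; by case.
rewrite /lebesgue_cons /pushforward.
rewrite (_ : _ @^-1` _ = `[a ord0, b ord0]%classic `*`
  [set v : 'rV[R]_n | forall i, v ord0 i \in
    `[a (lift ord0 i), b (lift ord0 i)]]); last first.
  apply/seteqP; split => [[x v]/= h|[x v]/= [h0 h1] i].
    split; first by have := h ord0; rewrite mxE unlift_none.
    by move=> i; have := h (lift ord0 i); rewrite mxE liftK.
  by rewrite mxE; case: (unliftP ord0 i) => [j ->|->].
rewrite product_measure1E//; last first.
  rewrite (_ : [set v | _] = \bigcap_(i in [set: 'I_n])
      ((fun v : 'rV[R]_n => v ord0 i) @^-1`
        `[a (lift ord0 i), b (lift ord0 i)])); last first.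
    by apply/seteqP; split => [v h i _|v h i]; exact: h.
  apply: fin_bigcap_measurable => // i _; rewrite -[X in measurable X]setTI.
  by apply: measurable_coord => //; exact: measurable_itv.
rewrite IH//; rewrite big_ord_recl EFinM; congr (_ * _)%E.
rewrite [LHS](@lebesgue_measure_itv R `[a ord0, b ord0])/= lte_fin EFinB.
by case: ltP => // ba; rewrite [b _](@le_anti _ _ (b ord0) (a ord0)) ?subee// ba ab.
Qed.

End lebesgue_rV.

(* P(X): Borel probability measures on R^d concentrated on X.  In this library
   measures are functions on all sets, so two of them represent the same element
   of P(X) when they agree on measurable sets, see [measure_same]. *)
Record prob_on (R : realType) (d : nat) (X : set 'rV[R]_d) := ProbOn {
  prob_on_val :> probability 'rV[R]_d R ;
  prob_on_full : prob_on_val X = 1%E }.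

HB.instance Definition _ (R : realType) (d : nat) (X : set 'rV[R]_d) :=
  gen_eqMixin (prob_on X).
HB.instance Definition _ (R : realType) (d : nat) (X : set 'rV[R]_d) :=
  gen_choiceMixin (prob_on X).

Definition measure_same d0 (T : measurableType d0) (R : realType)
    (P Q : set T -> \bar R) : Prop :=
  forall A, measurable A -> P A = Q A.

Definition abs_cont (R : realType) (d : nat) (X : set 'rV[R]_d)
    (P : prob_on X) : Prop :=
  P `<< lebesgue_rV R d.

(* The weak topology of P(X): the coarsest one making P |-> \int_X f dP
   continuous for every bounded continuous f : X -> R. *)
Section weak_topology.
Context (R : realType) (d : nat) (X : set 'rV[R]_d).

Record bounded_continuous := BoundedContinuous {
  bc_fun :> 'rV[R]_d -> R ;
  bc_continuous : {within X, continuous bc_fun} ;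
  bc_bounded : exists C : R, forall x, X x -> `|bc_fun x| <= C }.

Definition test_integrals (P : prob_on X) : {ptws bounded_continuous -> R} :=
  fun f => \int[P]_(x in X) f x.

HB.instance Definition _ :=
  Topological.copy (prob_on X) (initial_topology test_integrals).

End weak_topology.

(* The mixture (1 - e) P + e Q; e is clipped to [0, 1] to make it total. *)
Section mixture.
Context (R : realType) (d : nat) (X : set 'rV[R]_d) (P Q : prob_on X).

Definition clip01 (e : R) : R := Num.max 0 (Num.min 1 e).

Lemma clip01_ge0 e : 0 <= clip01 e.
Proof. by rewrite /clip01 le_max lexx. Qed.

Lemma onem_clip01_ge0 e : 0 <= 1 - clip01 e.
Proof. by rewrite subr_ge0 /clip01 ge_max ler01 ge_min lexx. Qed.

Lemma clip01_id e : 0 <= e <= 1 -> clip01 e = e.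
Proof. by move=> /andP[e0 e1]; rewrite /clip01 min_r// max_r. Qed.

Definition mixture_measure (e : R) : set 'rV[R]_d -> \bar R :=
  measure_add (mscale (NngNum (onem_clip01_ge0 e)) P)
              (mscale (NngNum (clip01_ge0 e)) Q).

HB.instance Definition _ e := Measure.on (mixture_measure e).

Lemma mixture_measureE e A : mixture_measure e A =
  ((1 - clip01 e)%:E * P A + (clip01 e)%:E * Q A)%E.
Proof. by rewrite /mixture_measure measure_addE. Qed.

Let mixture_measureT e : mixture_measure e setT = 1%E.
Proof.
by rewrite mixture_measureE !probability_setT !mule1 -EFinD subrK.
Qed.

HB.instance Definition _ e :=
  Measure_isProbability.Build _ _ _ (mixture_measure e) (mixture_measureT e).

Let mixture_measureX e : mixture_measure e X = 1%E.
Proof. by rewrite mixture_measureE !prob_on_full !mule1 -EFinD subrK. Qed.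

Definition mixture (e : R) : prob_on X := ProbOn (mixture_measureX e).

Lemma mixtureE e A : 0 <= e <= 1 ->
  mixture e A = ((1 - e)%:E * P A + e%:E * Q A)%E.
Proof.
by move=> e01; rewrite -[in RHS](clip01_id e01); exact: mixture_measureE.
Qed.

End mixture.

(* D is the (normalized) flat derivative of G : P(X) -> R; only the values of
   D P on X matter. *)
Section flat_derivative.
Context (R : realType) (d : nat) (X : set 'rV[R]_d).

Definition flat_integrand (D : prob_on X -> 'rV[R]_d -> R) (P Q : prob_on X)
    (e : R) : R :=
  \int[Q]_(x in X) D (mixture P Q e) x - \int[P]_(x in X) D (mixture P Q e) x.

Definition is_flat_derivative (G : prob_on X -> R)
    (D : prob_on X -> 'rV[R]_d -> R) : Prop :=
  [/\ {within [set: prob_on X] `*` X,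
         continuous (fun Px : prob_on X * 'rV[R]_d => D Px.1 Px.2)},
      forall P : prob_on X, exists C : R, forall x, X x -> `|D P x| <= C,
      forall P Q : prob_on X,
        lebesgue_measure.-integrable `[0, 1]
          (EFin \o (flat_integrand D P Q : measurableTypeR R -> R)) /\
        G Q - G P = \int[lebesgue_measure]_(e in `[0, 1]) flat_integrand D P Q e
    & forall P : prob_on X, \int[P]_(x in X) D P x = 0].

End flat_derivative.

Definition TV d0 (T : measurableType d0) (R : realType)
    (P Q : set T -> \bar R) : R :=
  sup [set `|fine (P A) - fine (Q A)| | A in measurable].

Section densities.
Context (R : realType) (d : nat) (X : set 'rV[R]_d).

Definition is_density (P : prob_on X) (p : 'rV[R]_d -> R) : Prop :=
  [/\ measurable_fun X p,
      forall x, X x -> 0 <= p x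
    & forall A, measurable A ->
        P A = (\int[lebesgue_rV R d]_(x in A `&` X) (p x)%:E)%E].

Definition normalized_exp (f : 'rV[R]_d -> R) (x : 'rV[R]_d) : R :=
  expR (f x) / \int[lebesgue_rV R d]_(z in X) expR (f z).

(* Curves indexed by [0, +oo[ are functions on R whose values at negative times
   are irrelevant; limits are taken within [0, +oo[, one-sidedly at 0. *)

Definition TV_continuous (P : R -> prob_on X) : Prop :=
  forall t, 0 <= t ->
    TV (P s) (P t) @[s --> within [set s | 0 <= s] (nbhs t)] --> (0 : R).

(* C^1([0, +oo[, P_ac(X)): P_ac(X) sits in L^1(X) through densities, with TV
   half the L^1 distance, and v is the derivative of the curve in L^1(X). *)
Definition C1_flow (P : R -> prob_on X) : Prop :=
  exists p v : R -> 'rV[R]_d -> R,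
  [/\ forall t, 0 <= t -> is_density (P t) (p t),
      forall t, 0 <= t -> (lebesgue_rV R d).-integrable X (EFin \o v t),
      forall t, 0 <= t ->
        (\int[lebesgue_rV R d]_(x in X)
           (`|h^-1 * (p (t + h) x - p t x) - v t x|%R)%:E)%E
        @[h --> within [set h | 0 <= t + h] (0 : R)^'] --> 0%E
    & forall t, 0 <= t ->
        (\int[lebesgue_rV R d]_(x in X) (`|v s x - v t x|%R)%:E)%E
        @[s --> within [set s | 0 <= s] (nbhs t)] --> 0%E].

End densities.

Definition has_derivative_ge0 (R : realType) (f : R -> R) (t l : R) : Prop :=
  h^-1 * (f (t + h) - f t) @[h --> within [set h | 0 <= t + h] (0 : R)^'] --> l.

Section best_response.
Context (R : realType) (d : nat) (X Y : set 'rV[R]_d).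
Variables (Upi Urho : 'rV[R]_d -> R) (sigma alpha : R).
Variables DnuF DmuF : prob_on X -> prob_on Y -> 'rV[R]_d -> R.

Definition Psi (nu : prob_on X) (mu : prob_on Y) : 'rV[R]_d -> R :=
  normalized_exp X (fun x => - (2 / sigma ^+ 2) * DnuF nu mu x - Upi x).

Definition Phi (nu : prob_on X) (mu : prob_on Y) : 'rV[R]_d -> R :=
  normalized_exp Y (fun y => 2 / sigma ^+ 2 * DmuF nu mu y - Urho y).

(* A TV-continuous curve in P_ac(X) x P_ac(Y) whose densities solve the MF-BR
   system pointwise. *)
Definition MFBR_flow (nu : R -> prob_on X) (mu : R -> prob_on Y) : Prop :=
  [/\ forall t, 0 <= t -> abs_cont (nu t) /\ abs_cont (mu t),
      TV_continuous nu, TV_continuous mu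
    & exists (p q : R -> 'rV[R]_d -> R),
      [/\ forall t, 0 <= t -> is_density (nu t) (p t),
          forall t, 0 <= t -> is_density (mu t) (q t),
          forall t x, 0 <= t -> X x ->
            has_derivative_ge0 (p ^~ x) t
              (alpha * (Psi (nu t) (mu t) x - p t x))
        & forall t y, 0 <= t -> Y y ->
            has_derivative_ge0 (q ^~ y) t
              (alpha * (Phi (nu t) (mu t) y - q t y))]].

End best_response.

(* Main.v *)
Require Import Defs.
From HB Require Import structures.
From mathcomp Require Import all_boot all_order all_algebra.
From mathcomp Require Import all_classical all_reals all_analysis.
From mathcomp Require Import measurable_realfun.
From mathcomp Require Import ring lra.

(* With U = - log of the reference density and w = e^{-U}, boundedness of the
   flat derivatives makes the best response V of a pair of densities satisfy
   V <= K w and |V(u) - V(v)| <= L w ||u - v||_1 pointwise.  The equation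
   u' = alpha (V(u) - u) can therefore be solved pointwise in x by Picard
   iteration for the norm sup_{t,x} e^{-kappa t} |u_t(x)| / w(x), in which the
   iteration contracts by 1/2; no completeness of L^1 is needed.  Each iterate
   remains a probability density, being a uniform limit of convex combinations
   of densities, and the same weight in time gives the stability estimate
   ||u_t - v_t||_1 <= 2 e^{kappa t} ||u_0 - v_0||_1, hence uniqueness and
   continuous dependence. *)

Set Implicit Arguments.
Unset Strict Implicit.
Unset Printing Implicit Defensive.
Import Order.TTheory GRing.Theory Num.Theory.
Import numFieldNormedType.Exports.

Local Open Scope classical_set_scope.
Local Open Scope ring_scope.

(** * One-sided derivatives *)

(** The weight has mass one, so a pointwise bound by [w * c] integrates to an L^1 bound by [c],
    which is what the next response estimate needs; domination by [w] also lets total masses pass to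
    limits. The initial density need not be dominated by a multiple of [w], so the weighted norm is
    applied only to differences of curves with the same initial value. To control the curves
    themselves, namely their Lipschitz continuity in time, a mixture of [u0] and [w] replaces [w].
    This continuity makes the response of an iterate a continuous forcing at each point, so that the
    scalar equation can be solved there. A solution built point by point is not visibly measurable
    in [x] or of mass one. Relaxation towards a constant forcing is exactly a convex combination, so
    time is discretized to recover both properties, and no time integral is exchanged with a space
    integral. Estimates in time compare increments of functions with ordered derivatives; the
    fundamental theorem of calculus serves only to construct a primitive. *)

Section one_sided_derivative.
Context {R : realType}.
Implicit Types f g : R -> R.

Lemma is_derive_has_derivative_ge0 f (t l : R) :
  is_derive t 1 f l -> has_derivative_ge0 f t l.
Proof.
move=> [df <-]; rewrite /has_derivative_ge0; apply: cvg_within_filter.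
rewrite /derive; apply: cvg_trans df; apply: near_eq_cvg; near=> h.
by rewrite /GRing.scale/= mulr1 (addrC h).
Unshelve. all: by end_near. Qed.

Lemma has_derivative_ge0_is_derive f (t l : R) :
  0 < t -> has_derivative_ge0 f t l -> is_derive t 1 f l.
Proof.
move=> t0 fl.
have {}fl : (h^-1 *: (f (h *: 1 + t) - f t)) @[h --> 0^'] --> l.
  move/cvgrPdist_lt: fl => fl; apply/cvgrPdist_lt => e e0.
  (* A radius at most [t] keeps [t + h] nonnegative, which is where the one-sided limit gives
     information. *)
  have [d /= d0 fd] := fl e e0; exists (Num.min d t) => /=;
    first by rewrite lt_min d0.
  move=> h; rewrite /ball/= lt_min sub0r normrN => /andP[hd ht] h0.
  rewrite /GRing.scale/= mulr1 (addrC h); apply: fd => //.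
    by rewrite /ball/= sub0r normrN.
  by have := ler_norm (- h); rewrite normrN => ht'; lra.
by apply: DeriveDef; [apply/cvg_ex; exists l|apply/cvg_lim].
Qed.

Lemma has_derivative_ge0_cvg f (t l : R) : has_derivative_ge0 f t l ->
  f (t + h) @[h --> within [set h | 0 <= t + h] (0 : R)^'] --> f t.
Proof.
move=> fl; rewrite -[X in _ --> X]addr0 -[X in _ --> _ + X](mul0r l).
have : f t + h * (h^-1 * (f (t + h) - f t))
    @[h --> within [set h | 0 <= t + h] (0 : R)^'] --> f t + 0 * l.
  apply: cvgD; first exact: cvg_cst.
  by apply: cvgM => //; apply: cvg_within_filter; exact: nbhs_dnbhs.
apply: cvg_trans; apply: near_eq_cvg; apply: cvg_within; near=> h.
by rewrite mulrA divff ?mul1r ?subrKC//; near: h; exact: nbhs_dnbhs_neq.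
Unshelve. all: by end_near. Qed.

Lemma has_derivative_ge0_continuous f (t l : R) : has_derivative_ge0 f t l ->
  f s @[s --> within [set s | 0 <= s] (nbhs t)] --> f t.
Proof.
move=> /has_derivative_ge0_cvg/cvgrPdist_lt fc; apply/cvgrPdist_lt => e e0.
have [d /= d0 fd] := fc e e0; exists d => //= s ts s0.
have [->|st] := eqVneq s t; first by rewrite subrr normr0.
have := fd (s - t); rewrite subrKC; apply => //.
- by move: ts; rewrite /ball/= distrC sub0r normrN.
- by rewrite subr_eq0.
Qed.

Lemma has_derivative_ge0_ext f g (t l : R) : 0 <= t ->
  (forall s, 0 <= s -> f s = g s) ->
  has_derivative_ge0 f t l -> has_derivative_ge0 g t l.
Proof.
move=> t0 fg; apply: cvg_trans; apply: near_eq_cvg.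
rewrite /within/= near_withinE; near=> h => th.
by rewrite !fg.
Unshelve. all: by end_near. Qed.

Lemma has_derivative_ge0B f g (t l m : R) :
  has_derivative_ge0 f t l -> has_derivative_ge0 g t m ->
  has_derivative_ge0 (fun s => f s - g s) t (l - m).
Proof.
move=> fl gm; apply: cvg_trans (cvgB fl gm); apply: near_eq_cvg.
by near=> h; rewrite !fctE/=; ring.
Unshelve. all: by end_near. Qed.

Lemma has_derivative_ge0M f g (t l m : R) :
  has_derivative_ge0 f t l -> has_derivative_ge0 g t m ->
  has_derivative_ge0 (fun s => f s * g s) t (l * g t + f t * m).
Proof.
move=> fl gm; have gc := has_derivative_ge0_cvg gm.
apply: cvg_trans (cvgD (cvgM fl gc) (cvgM (cvg_cst (f t)) gm));
  apply: near_eq_cvg.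
by near=> h; rewrite !fctE/=; ring.
Unshelve. all: by end_near. Qed.

(** Inside the interval [g - f] has a nonnegative two-sided derivative, and it is continuous up to
    the end points, hence nondecreasing. *)
Lemma has_derivative_ge0_increment_le f g (f' g' : R -> R) (a b : R) :
  0 <= a -> a <= b ->
  (forall t, 0 <= t -> has_derivative_ge0 f t (f' t)) ->
  (forall t, 0 <= t -> has_derivative_ge0 g t (g' t)) ->
  (forall t, a <= t -> t <= b -> f' t <= g' t) ->
  f b - f a <= g b - g a.
Proof.
move=> a0 ab df dg fg.
pose k t := g t - f t.
have dk t : 0 <= t -> has_derivative_ge0 k t (g' t - f' t).
  by move=> t0; apply: has_derivative_ge0B; [exact: dg|exact: df].
have dk1 t : t \in `]a, b[ -> is_derive t 1 k (g' t - f' t).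
  rewrite in_itv/= => /andP[at_ tb].
  by apply: has_derivative_ge0_is_derive; [lra|apply: dk; lra].
suff : k a <= k b by rewrite /k; lra.
apply: (@ger0_derive1_ndecr _ k a b) => // [t /dk1[]//|t tab|].
  have [_] := dk1 _ tab; rewrite derive1E => ->.
  by move: tab; rewrite in_itv/= subr_ge0 => /andP[/ltW ? /ltW ?]; exact: fg.
apply/subspace_continuousP => t /=; rewrite in_itv/= => /andP[at_ tb].
apply: cvg_trans (has_derivative_ge0_continuous (dk t (le_trans a0 at_))).
apply: cvg_fmap2; apply: within_subset => s /=.
by rewrite in_itv/= => /andP[+ _]; exact: le_trans.
Qed.

(** Plays the role of the triangle inequality for time integrals: [g] is a primitive of a bound on
    the speed of [f]. The comparison is applied to [f] and to [0 - f]. *)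
Lemma has_derivative_ge0_increment_norm f g (f' g' : R -> R) (a b : R) :
  0 <= a -> a <= b ->
  (forall t, 0 <= t -> has_derivative_ge0 f t (f' t)) ->
  (forall t, 0 <= t -> has_derivative_ge0 g t (g' t)) ->
  (forall t, a <= t -> t <= b -> `|f' t| <= g' t) ->
  `|f b - f a| <= g b - g a.
Proof.
move=> a0 ab df dg fg; rewrite ler_norml; apply/andP; split; last first.
  apply: (has_derivative_ge0_increment_le a0 ab df dg) => t at_ tb.
  exact: le_trans (ler_norm _) (fg _ at_ tb).
rewrite lerNl opprB.
have df' t : 0 <= t -> has_derivative_ge0 (fun s => 0 - f s) t (0 - f' t).
  move=> t0; apply: has_derivative_ge0B (df _ t0).
  exact: is_derive_has_derivative_ge0.
have := has_derivative_ge0_increment_le a0 ab df' dg.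
rewrite !sub0r opprK addrC; apply => t at_ tb.
by rewrite sub0r; apply: le_trans (fg _ at_ tb); rewrite -normrN ler_norm.
Qed.

Lemma has_derivative_ge0_expR (c t : R) :
  has_derivative_ge0 (fun s => expR (c * s)) t (c * expR (c * t)).
Proof.
apply: is_derive_has_derivative_ge0; apply: is_derive_eq.
by rewrite /GRing.scale/= mulr1 mulrC.
Qed.

Lemma has_derivative_ge0_scale_expR (k c t : R) :
  has_derivative_ge0 (fun s => k * expR (c * s)) t (k * c * expR (c * t)).
Proof.
have := has_derivative_ge0M (is_derive_has_derivative_ge0 (is_derive_cst k t 1))
  (@has_derivative_ge0_expR c t).
by rewrite mul0r add0r mulrA.
Qed.

Lemma has_derivative_ge0_scale_id (k t : R) :
  has_derivative_ge0 (fun s => k * s) t k.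
Proof.
apply: is_derive_has_derivative_ge0; apply: is_derive_eq.
by rewrite /GRing.scale/= mulr1.
Qed.

Lemma exists_primitive_ge0 f : continuous f ->
  exists2 g : R -> R, g 0 = 0 &
    forall t, 0 <= t -> has_derivative_ge0 g t (f t).
Proof.
(* Integrating from -1 makes every [t >= 0], including 0, an interior point of the interval, so that
   [G] has a two-sided derivative there. *)
move=> cf; pose G (t : R) := \int[lebesgue_measure]_(s in `[-1, t]) f s.
exists (fun t => G t - G 0); first exact: subrr.
move=> t t0; rewrite -[f t]subr0; apply: has_derivative_ge0B; last first.
  exact: is_derive_has_derivative_ge0.
apply: is_derive_has_derivative_ge0.
have [] := @continuous_FTC1_closed R f (-1) t (t + 1).
- lra.
- apply: continuous_compact_integrable; first exact: segment_compact.
  exact: continuous_subspaceT.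
- lra.
- exact: cf.
by move=> dG G'; split => //; rewrite -derive1E.
Qed.

End one_sided_derivative.

(** * The relaxation equation *)

Lemma difference_quotient_lipschitz {R : realType} (f f' : R -> R) (A : R) :
  (forall t, 0 <= t -> has_derivative_ge0 f t (f' t)) ->
  (forall s t, 0 <= s -> 0 <= t -> `|f' t - f' s| <= A * `|t - s|) ->
  forall t h, 0 <= t -> 0 <= t + h -> h != 0 ->
    `|h^-1 * (f (t + h) - f t) - f' t| <= A * `|h|.
Proof.
move=> df lipf'.
have A0 : 0 <= A.
  have := lipf' 0 1 (lexx _) ler01; rewrite subr0 normr1 mulr1.
  exact: le_trans.
(* Subtracting the tangent slope at [r] leaves a function of speed at most [A * (b - a)] on
   [[a, b]]. The base point is free in the interval because [r = a] serves [h >= 0] and [r = b]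
   serves [h < 0]. *)
have key a b r : 0 <= a -> a <= r -> r <= b ->
    `|f b - f a - f' r * (b - a)| <= A * (b - a) * (b - a).
  move=> a0 ar rb; rewrite (_ : f b - f a - _ =
    (f b - f' r * b) - (f a - f' r * a)); last by ring.
  rewrite (_ : A * _ * _ = A * (b - a) * b - A * (b - a) * a); last by ring.
  apply: (@has_derivative_ge0_increment_norm _ (fun s => f s - f' r * s)
    (fun s => A * (b - a) * s) (fun s => f' s - f' r) (fun=> A * (b - a))) =>
      //.
  - exact: le_trans rb.
  - move=> s s0; apply: has_derivative_ge0B; first exact: df.
    exact: has_derivative_ge0_scale_id.
  - by move=> s s0; exact: has_derivative_ge0_scale_id.
  - move=> s as_ sb; apply: le_trans (lipf' _ _ _ _) _; [lra|lra|].
    by rewrite ler_wpM2l// ler_norml; apply/andP; split; lra.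
move=> t h t0 th0 hn0.
have H : `|f (t + h) - f t - f' t * h| <= A * `|h| * `|h|.
  have [h0|h0] := leP 0 h.
    have tth : t <= t + h by rewrite lerDl.
    have := key _ _ _ t0 (lexx _) tth; rewrite (ger0_norm h0).
    by have -> : t + h - t = h by ring.
  have tht : t + h <= t by rewrite gerDl ltW.
  have := key _ _ _ th0 tht (lexx _); rewrite (ltr0_norm h0) -normrN.
  have -> : t - (t + h) = - h by ring.
  by have -> : - (f t - f (t + h) - f' t * - h) = f (t + h) - f t - f' t * h by
    ring.
rewrite -(@ler_pM2r _ `|h|) ?normr_gt0// -normrM.
by rewrite (_ : (_ - f' t) * h = f (t + h) - f t - f' t * h)//; field.
Qed.

Section relaxation_equation.
Context {R : realType} (alpha : R).
Hypothesis alpha_gt0 : 0 < alpha.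
Implicit Types p theta : R -> R.

(** The MF-BR system at one point of the state space, with [theta t] for the value there of the best
    response at time [t]. *)
Definition relaxes theta p : Prop :=

  forall t : R, 0 <= t -> has_derivative_ge0 p t (alpha * (theta t - p t)).

Lemma relaxesB theta1 theta2 p1 p2 : relaxes theta1 p1 -> relaxes theta2 p2 ->
  relaxes (fun t => theta1 t - theta2 t) (fun t => p1 t - p2 t).
Proof.
move=> h1 h2 t t0; rewrite [X in has_derivative_ge0 _ _ X](_ : _ =
  alpha * (theta1 t - p1 t) - alpha * (theta2 t - p2 t)); last by ring.
by apply: has_derivative_ge0B; [exact: h1|exact: h2].
Qed.

Lemma relaxes_expR theta p : relaxes theta p -> forall t : R, 0 <= t ->
  has_derivative_ge0 (fun s => p s * expR (alpha * s)) t
    (alpha * expR (alpha * t) * theta t).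
Proof.
move=> hp t t0; rewrite [X in has_derivative_ge0 _ _ X](_ : _ =
  alpha * (theta t - p t) * expR (alpha * t) +
  p t * (alpha * expR (alpha * t))); last by ring.
by apply: has_derivative_ge0M; [exact: hp|exact: has_derivative_ge0_expR].
Qed.

(** For a constant forcing [q] the convex combination is the exact solution. A deviation [e] of the
    forcing enters only with the weight that the forcing itself has in the combination. *)
Lemma relaxes_step theta p (a b q e : R) : relaxes theta p ->
  0 <= a -> a <= b -> (forall t : R, a <= t -> t <= b -> `|theta t - q| <= e) ->
  `|p b - (expR (- (alpha * (b - a))) * p a +
           (1 - expR (- (alpha * (b - a)))) * q)| <=
  (1 - expR (- (alpha * (b - a)))) * e.
Proof.
move=> hp a0 ab thetaq.
have hpq : relaxes (fun t => theta t - q) (fun t => p t - q).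
  apply: relaxesB => // t t0; rewrite subrr mulr0.
  exact: is_derive_has_derivative_ge0.
have ge_ t := @has_derivative_ge0_scale_expR R e alpha t.
have Eab : expR (- (alpha * (b - a))) = expR (alpha * a) / expR (alpha * b).
  by rewrite -expRB; congr expR; ring.
have Eb := expR_gt0 (alpha * b).
have H : `|(p b - q) * expR (alpha * b) - (p a - q) * expR (alpha * a)| <=
    e * expR (alpha * b) - e * expR (alpha * a).
  apply: (has_derivative_ge0_increment_norm a0 ab (relaxes_expR hpq)
    (fun t _ => ge_ t)) => t at_ tb.
  rewrite normrM ger0_norm; last by rewrite mulr_ge0 ?expR_ge0 ?ltW.
  rewrite -[e * _ * _]mulrA [leRHS]mulrC ler_wpM2l ?thetaq//.
  by rewrite mulr_ge0 ?expR_ge0 ?ltW.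
rewrite Eab -(@ler_pM2r _ (expR (alpha * b)))//.
rewrite -[X in _ * X <= _]ger0_norm ?expR_ge0// -normrM.
rewrite (_ : (p b - _) * _ = (p b - q) * expR (alpha * b) -
  (p a - q) * expR (alpha * a)); last by field; exact: lt0r_neq0.
rewrite (_ : (1 - _) * e * _ = e * expR (alpha * b) - e * expR (alpha * a))//.
by field; exact: lt0r_neq0.
Qed.

(** A forcing of size [A * expR (kappa * t)] is amplified at most by [alpha / (alpha + kappa)], and
    [c] is any upper bound of this gain. A large [kappa] makes the gain small, which drives the
    contraction; [kappa = 0], [c = 1] gives plain boundedness. *)
Lemma relaxes_expR_bound theta p (A kappa c : R) : relaxes theta p ->
  0 <= A -> 0 <= kappa -> alpha <= c * (alpha + kappa) ->
  (forall t : R, 0 <= t -> `|theta t| <= A * expR (kappa * t)) ->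
  forall t : R, 0 <= t ->
    `|p t - expR (- (alpha * t)) * p 0| <= c * A * expR (kappa * t).
Proof.
move=> hp A0 k0 ck thetaA t t0.
have gd s := @has_derivative_ge0_scale_expR R (c * A) (alpha + kappa) s.
have H : `|p t * expR (alpha * t) - p 0 * expR (alpha * 0)| <=
    c * A * expR ((alpha + kappa) * t) - c * A * expR ((alpha + kappa) * 0).
  apply: (has_derivative_ge0_increment_norm (lexx 0) t0 (relaxes_expR hp)
    (fun s _ => gd s)) => s s0 _.
  rewrite normrM ger0_norm; last by rewrite mulr_ge0 ?expR_ge0 ?ltW.
  rewrite mulrDl expRD.
  apply: (@le_trans _ _ (alpha * expR (alpha * s) * (A * expR (kappa * s)))).
    by rewrite ler_wpM2l ?thetaA// mulr_ge0 ?expR_ge0 ?ltW.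
  rewrite (_ : alpha * _ * _ = alpha * (A * (expR (alpha * s) *
    expR (kappa * s)))); last by ring.
  rewrite (_ : c * A * _ * _ = c * (alpha + kappa) * (A * (expR (alpha * s) *
    expR (kappa * s)))); last by ring.
  by rewrite ler_wpM2r// !mulr_ge0 ?expR_ge0.
have Et := expR_gt0 (alpha * t).
rewrite expRN -(@ler_pM2r _ (expR (alpha * t)))//.
rewrite -[X in _ * X <= _]ger0_norm ?expR_ge0// -normrM.
have ak : 0 < alpha + kappa by rewrite ltr_wpDr.
have c0 : 0 <= c.
  by rewrite -(pmulr_lge0 _ ak) (le_trans _ ck)// ltW.
have cA : 0 <= c * A by rewrite mulr_ge0.
move: H; rewrite !mulr0 expR0 !mulr1 mulrDl expRD => H.
rewrite (_ : (p t - _) * _ = p t * expR (alpha * t) - p 0); last first.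
  by field; exact: lt0r_neq0.
apply: (le_trans H); rewrite -subr_ge0.
by rewrite (_ : _ - _ = c * A)//; ring.
Qed.

Section bounded_relaxation.
Variables (theta p : R -> R) (B : R).
Hypothesis theta_p : relaxes theta p.
Hypothesis p0_ge0 : 0 <= p 0.
Hypothesis thetaB : forall t : R, 0 <= t -> 0 <= theta t <= B.

Lemma relaxes_ge0 (t : R) : 0 <= t -> 0 <= p t.
Proof.
move=> t0; have zd s : has_derivative_ge0 (fun=> 0 : R) s 0.
  exact: is_derive_has_derivative_ge0.
have : 0 - 0 <= p t * expR (alpha * t) - p 0 * expR (alpha * 0).
  apply: (@has_derivative_ge0_increment_le R (fun=> 0) _ (fun=> 0) _ 0 t
    (lexx 0) t0 (fun s _ => zd s) (relaxes_expR theta_p)) => s s0 _.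
  have /andP[? _] := thetaB s0.
  by rewrite mulr_ge0// mulr_ge0 ?expR_ge0 ?ltW.
rewrite !mulr0 expR0 mulr1 .
rewrite subrr subr_ge0 => /(le_trans p0_ge0).
by rewrite pmulr_lge0 ?expR_gt0.
Qed.

Lemma relaxes_le (t : R) : 0 <= t -> p t <= p 0 + B.
Proof.
move=> t0.
have B0 : 0 <= B by have /andP[] := thetaB (lexx 0); exact: le_trans.
have : `|p t - expR (- (alpha * t)) * p 0| <= 1 * B * expR (0 * t).
  apply: (relaxes_expR_bound theta_p) => //; first by rewrite mul1r addr0.
  move=> s s0.
  by rewrite mul0r expR0 mulr1; have /andP[? ?] := thetaB s0; rewrite ger0_norm.
rewrite mul0r expR0 mulr1 mul1r ler_norml => /andP[_].
have : expR (- (alpha * t)) * p 0 <= 1 * p 0.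
  by rewrite ler_wpM2r// -expR0 ler_expR oppr_le0 mulr_ge0// ltW.
lra.
Qed.

Lemma relaxes_rate_le (t : R) : 0 <= t -> `|alpha * (theta t - p t)| <=
  alpha * (p 0 + B).
Proof.
move=> t0; rewrite normrM gtr0_norm// ler_wpM2l ?(ltW alpha_gt0)//.
have := relaxes_ge0 t0; have := relaxes_le t0; have /andP[] := thetaB t0.
set c := p 0; have c0 : 0 <= c := p0_ge0;
  move: (p t) (theta t) c c0 => x y c c0.
by move=> ? ? ? ?; rewrite ler_norml; apply/andP; split; lra.
Qed.

Lemma relaxes_lipschitz (s t : R) : 0 <= s -> 0 <= t ->
  `|p t - p s| <= (p 0 + B) * (alpha * `|t - s|).
Proof.
wlog st : s t / s <= t.
  move=> H s0 t0; have [/H|/ltW/H] := leP s t; first exact.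
  by rewrite distrC (distrC t); exact.
move=> s0 t0; rewrite (ger0_norm (_ : 0 <= t - s)); last by lra.
have gd r := @has_derivative_ge0_scale_id R (alpha * (p 0 + B)) r.
rewrite (_ : (p 0 + B) * _ =
  alpha * (p 0 + B) * t - alpha * (p 0 + B) * s); last by ring.
apply: (has_derivative_ge0_increment_norm s0 st theta_p (fun r _ => gd r)).
by move=> r sr _; apply: relaxes_rate_le; lra.
Qed.

End bounded_relaxation.

End relaxation_equation.

(** The limit is the supremum of the lower bounds [a n - e n], where [e n] is the tail of the
    geometric series from [n] on; the explicit rate of convergence comes with this construction. *)
Lemma geometric_cauchy_limit {R : realType} (a : nat -> R) (c : R) :
  (forall n, `|a n.+1 - a n| <= c * 2^-1 ^+ n) ->
  exists l, forall n, `|l - a n| <= c * 2 * 2^-1 ^+ n.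
Proof.
move=> ac.
have c0 : 0 <= c by have := ac 0%N; rewrite expr0 mulr1; exact: le_trans.
pose e n : R := c * 2 * 2^-1 ^+ n.
have eS n : e n.+1 = e n - c * 2^-1 ^+ n by rewrite /e exprS; field.
have aDe n k : `|a (n + k)%N - a n| <= e n - e (n + k)%N.
  elim: k => [|k IH]; first by rewrite addn0 !subrr normr0.
  rewrite addnS eS.
  have := ler_normD (a (n + k).+1 - a (n + k)%N) (a (n + k)%N - a n).
  have -> : a (n + k).+1 - a (n + k)%N + (a (n + k)%N - a n) =
    a (n + k).+1 - a n by ring.
  have := ac (n + k)%N; lra.
have e0 n : 0 <= e n by rewrite !mulr_ge0// exprn_ge0// invr_ge0.
have ae m n : a m - e m <= a n + e n.
  have [mn|/ltnW nm] := leqP m n.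
    by have := aDe m (n - m)%N; rewrite subnKC// ler_norml => /andP[? ?];
      have := e0 n; lra.
  by have := aDe n (m - n)%N; rewrite subnKC// ler_norml => /andP[? ?];
    have := e0 m; lra.
pose E := range (fun n => a n - e n).
have hE : has_sup E.
  split; first by exists (a 0%N - e 0%N); exists 0%N.
  by exists (a 0%N + e 0%N) => _ [n _ <-].
exists (sup E) => n; rewrite -/(e n) ler_norml; apply/andP; split.
  by have : a n - e n <= sup E; [apply: sup_upper_bound => //; exists n|lra].
have : sup E <= a n + e n; last by lra.
by apply: ge_sup; [exact: hE.1|move=> _ [m _ <-]].
Qed.

(** The witness satisfies [c / e < n + 1 <= 2 ^ n]. *)
Lemma exists_geometric_le {R : realType} (c e : R) : 0 < e ->
  exists n, c * 2^-1 ^+ n <= e.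
Proof.
move=> e0; exists (Num.truncn (c / e)); rewrite exprVn ler_pdivrMr ?exprn_gt0//.
rewrite [leRHS]mulrC -ler_pdivrMr// (le_trans (ltW (truncnS_gt _)))//.
by rewrite -natrX ler_nat ltn_expl.
Qed.

(** * Probability densities and the L^1 distance *)

Section density_functions.
Context d (T : measurableType d) (R : realType).
Variables (lam : {measure set T -> \bar R}) (X : set T).
Hypothesis mX : measurable X.
Implicit Types p q w : T -> R.

Definition density_fun p : Prop :=
  [/\ measurable_fun X p, forall x, X x -> 0 <= p x
    & (\int[lam]_(x in X) (p x)%:E = 1)%E].

Definition L1dist p q : R := \int[lam]_(x in X) `|p x - q x|.

Lemma density_fun_integrable p : density_fun p ->
  lam.-integrable X (EFin \o p).
Proof.
move=> [mp p0 p1]; apply/integrableP; split; first exact/measurable_EFinP.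
under eq_integral => x /[!inE] Xx do rewrite /= ger0_norm ?p0//.
by rewrite p1 ltry.
Qed.

Lemma density_fun_Rintegral p : density_fun p -> \int[lam]_(x in X) p x = 1.
Proof. by move=> [_ _ p1]; rewrite /Rintegral p1. Qed.

Lemma L1dist_integrable p q : density_fun p -> density_fun q ->
  lam.-integrable X (fun x => `|p x - q x|%:E).
Proof.
move=> /density_fun_integrable ip /density_fun_integrable iq.
by have := integrable_abse (integrableB mX ip iq).
Qed.

Lemma L1dist_ge0 p q : 0 <= L1dist p q.
Proof. exact: Rintegral_ge0. Qed.

Lemma integral_le_scale p w (c : R) : density_fun w ->
  measurable_fun X p -> (forall x, X x -> `|p x| <= w x * c) ->
  \int[lam]_(x in X) `|p x| <= c.
Proof.
move=> dw mp pwc; have iw := density_fun_integrable dw.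
have iwc : lam.-integrable X (EFin \o (fun x => w x * c)).
  by have := integrableZr mX c iw; exact: eq_integrable.
rewrite -[leRHS]mul1r -(density_fun_Rintegral dw) -RintegralZr//.
apply: le_Rintegral => //.
apply: le_integrable iwc => //.
  exact/measurable_EFinP/measurableT_comp.
by move=> x Xx; rewrite /= normr_id lee_fin (le_trans (pwc _ Xx))// ler_norm.
Qed.

Lemma L1dist_le p q w (c : R) : density_fun w ->
  density_fun p -> density_fun q ->
  (forall x, X x -> `|p x - q x| <= w x * c) -> L1dist p q <= c.
Proof.
move=> dw [mp _ _] [mq _ _] pq; apply: (integral_le_scale dw) => //.
exact: measurable_funB.
Qed.

Lemma L1dist_le_add p q p' q' w (c : R) : density_fun w ->
  density_fun p -> density_fun q -> density_fun p' -> density_fun q' ->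
  (forall x, X x -> `|p x - q x| <= `|p' x - q' x| + w x * c) ->
  L1dist p q <= L1dist p' q' + c.
Proof.
move=> dw dp dq dp' dq' pq; have iw := density_fun_integrable dw.
have iwc : lam.-integrable X (EFin \o (fun x => w x * c)).
  by have := integrableZr mX c iw; exact: eq_integrable.
have i' := L1dist_integrable dp' dq'.
rewrite -[X in _ + X]mul1r -(density_fun_Rintegral dw) -RintegralZr//.
rewrite -RintegralD//; apply: le_Rintegral => //;
  first exact: L1dist_integrable.
by have := integrableD mX i' iwc; exact: eq_integrable.
Qed.

Lemma L1dist_le2 p q : density_fun p -> density_fun q -> L1dist p q <= 2.
Proof.
move=> dp dq; have ip := density_fun_integrable dp.
have iq := density_fun_integrable dq.
have -> : 2 = \int[lam]_(x in X) (p x + q x).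
  by rewrite RintegralD// !density_fun_Rintegral.
apply: le_Rintegral => //; first exact: L1dist_integrable.
  by have := integrableD mX ip iq; exact: eq_integrable.
move=> x Xx; have [[_ /(_ x Xx) p0 _] [_ /(_ x Xx) q0 _]] := (dp, dq).
by rewrite ler_norml; apply/andP; split; lra.
Qed.

Lemma density_fun_convex p q (c : R) : 0 <= c <= 1 ->
  density_fun p -> density_fun q ->
  density_fun (fun x => c * p x + (1 - c) * q x).
Proof.
move=> /andP[c0 c1] [mp p0 p1] [mq q0 q1]; split.
- by apply: measurable_funD; apply: measurable_funM.
- by move=> x Xx; rewrite addr_ge0// mulr_ge0 ?p0 ?q0// subr_ge0.
- under eq_integral do rewrite EFinD !EFinM.
  rewrite ge0_integralD//; last 4 first.
  + by move=> x Xx; rewrite lee_fin mulr_ge0// p0.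
  + by apply/measurable_EFinP; exact: measurable_funM.
  + by move=> x Xx; rewrite lee_fin mulr_ge0 ?q0// subr_ge0.
  + by apply/measurable_EFinP; exact: measurable_funM.
  have Z (r : T -> R) (k : R) : 0 <= k -> measurable_fun X r ->
    (forall x, X x -> 0 <= r x) ->
      (\int[lam]_(x in X) (k%:E * (r x)%:E) =
       k%:E * \int[lam]_(x in X) (r x)%:E)%E.
    move=> k0 mr r0; rewrite ge0_integralZl_EFin//.
    exact/measurable_EFinP.
  have cN1 : 0 <= 1 - c by rewrite subr_ge0.
  have := Z q _ cN1 mq q0; have := Z p _ c0 mp p0;
    rewrite p1 q1 !mule1 => -> ->.
  by rewrite -EFinD subrKC.
Qed.

(** Pointwise limits inherit measurability and sign. The mass is inherited because the error [w * e]
    integrates to [e]. *)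
Lemma density_fun_closed p w : density_fun w ->
  (forall e : R, 0 < e -> exists2 u, density_fun u &
     forall x, X x -> `|p x - u x| <= w x * e) ->
  density_fun p.
Proof.
move=> dw pu; have [mw w0 w1] := dw.
have n0 n : 0 < n.+1%:R^-1 :> R by [].
have /choice[u up] n : exists u, density_fun u /\
    forall x, X x -> `|p x - u x| <= w x * n.+1%:R^-1.
  by have [u] := pu _ (n0 n); exists u.
have cvg_u x : X x -> u n x @[n --> \oo] --> p x.
  move=> Xx; have cvg_e : w x * n.+1%:R^-1 @[n --> \oo] --> (0 : R).
    by rewrite -(mulr0 (w x)); apply: cvgM;
      [exact: cvg_cst|exact: cvg_harmonic].
  apply/cvgrPdist_le => e e0; move/cvgrPdist_le: cvg_e => /(_ _ e0).
  apply: filterS => n /=; rewrite sub0r normrN => /(le_trans (ler_norm _)).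
  by apply: le_trans; exact: (up n).2.
have mp : measurable_fun X p.
  by apply: (measurable_fun_cvg (h := u)) => // n; have [[]] := up n.
have ip e u' : density_fun u' -> (forall x, X x -> `|p x - u' x| <= w x * e) ->
    lam.-integrable X (EFin \o (fun x => p x - u' x)).
  move=> [mu' _ _] pu'.
  have : lam.-integrable X (EFin \o (fun x => w x * e)).
    have := integrableZr mX e (density_fun_integrable dw); exact: eq_integrable.
  apply: le_integrable => //; first exact/measurable_EFinP/measurable_funB.
  by move=> x Xx /=; rewrite lee_fin (le_trans (pu' _ Xx))// ler_norm.
have intp : lam.-integrable X (EFin \o p).
  have du := (up 0%N).1.
  have := integrableD mX (ip _ _ du (up 0%N).2) (density_fun_integrable du).
  by apply: eq_integrable => // x _; rewrite /= -EFinD subrK.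
split => // [x Xx|].
  rewrite -(cvg_lim _ (cvg_u _ Xx))//; apply: limr_ge;
    first exact: cvgP (cvg_u _ Xx).
  by near=> n; have [[_ + _] _] := up n; exact.
suff : `|\int[lam]_(x in X) p x - 1| <= 0.
  rewrite normr_le0 subr_eq0 => /eqP <-.
  by rewrite fineK//; exact: integrable_fin_num.
apply/ler_addgt0Pl => e e0; rewrite addr0.
have [u' du' pu'] := pu _ e0.
rewrite -(density_fun_Rintegral du') -RintegralB//; last first.
  exact: density_fun_integrable.
apply: (@le_trans _ _ (\int[lam]_(x in X) `|p x - u' x|)).
  exact: le_normr_Rintegral (ip _ _ du' pu').
apply: (integral_le_scale dw) => //.
by have [mu' _ _] := du'; exact: measurable_funB.
Unshelve. all: by end_near. Qed.

End density_functions.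

(** * Relaxation towards a curve of densities *)

Section density_relaxation.
Context d (T : measurableType d) (R : realType).
Variables (lam : {measure set T -> \bar R}) (X : set T).
Hypothesis mX : measurable X.
Variables (alpha Lam : R) (w p0 : T -> R) (Theta : R -> T -> R).
Hypothesis alpha_gt0 : 0 < alpha.
Hypothesis dw : density_fun lam X w.
Hypothesis dp0 : density_fun lam X p0.
Hypothesis dTheta : forall t : R, 0 <= t -> density_fun lam X (Theta t).
Hypothesis Lam_ge0 : 0 <= Lam.
Hypothesis Theta_lip : forall s t x, 0 <= s -> 0 <= t -> X x ->
  `|Theta t x - Theta s x| <= w x * (Lam * `|t - s|).

Let relaxes_pointwise_solution (x : T) : exists p : R -> R, X x ->
  p 0 = p0 x /\ relaxes alpha (Theta ^~ x) p.
Proof.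
have [Xx|nXx] := pselect (X x); last by exists (fun=> 0).
(* The absolute value extends the forcing to negative times, making [f] continuous on the whole
   line; the solution then comes from the variation-of-constants formula. *)
pose f t := alpha * expR (alpha * t) * Theta `|t| x.
have cf : continuous f.
  move=> t; apply: cvgM.
    apply: cvgM; first exact: cvg_cst.
    apply: continuous_comp; last exact: continuous_expR.
    by apply: cvgM; [exact: cvg_cst|exact: cvg_id].
  apply/cvgrPdist_le => e e0.
  have w0 : 0 <= w x by have [_ + _] := dw; exact.
  have wL0 : 0 < w x * Lam + 1 by rewrite ltr_wpDl// mulr_ge0.
  near=> s; rewrite (le_trans (Theta_lip _ _ _))//.
  rewrite (@le_trans _ _ ((w x * Lam + 1) * `|t - s|))//.
    rewrite mulrA ler_pM// ?mulr_ge0//; first by rewrite lerDl.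
    exact: ler_dist_dist.
  rewrite mulrC -ler_pdivlMr//; near: s.
  by apply: cvgr_dist_le; [exact: cvg_id|exact: divr_gt0].
have [g g0 dg] := exists_primitive_ge0 cf.
exists (fun t => expR (- alpha * t) * (p0 x + g t)) => _; split.
  by rewrite mulr0 expR0 mul1r g0 addr0.
move=> t t0.
rewrite [X in has_derivative_ge0 _ _ X](_ : _ =
    - alpha * expR (- alpha * t) * (p0 x + g t) +
    expR (- alpha * t) * (f t - 0)).
  apply: has_derivative_ge0M; first exact: has_derivative_ge0_expR.
  have := has_derivative_ge0B (dg t t0)
    (is_derive_has_derivative_ge0 (is_derive_cst (- p0 x) t 1)).
  by apply: has_derivative_ge0_ext => // s _; rewrite opprK addrC.
rewrite /f ger0_norm// subr0 mulNr expRN.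
by field; exact: lt0r_neq0 (expR_gt0 _).
Unshelve. all: by end_near. Qed.

(* On the grid of step h, the variation-of-constants formula turns the solution
   into a convex combination of p0 and the densities Theta (k h), up to an error
   w * (Lam * h) that does not accumulate; in the limit it is a density. *)
Lemma density_relaxation : exists p : R -> T -> R,
  [/\ p 0 = p0, forall t, 0 <= t -> density_fun lam X (p t)
    & forall x, X x -> relaxes alpha (Theta ^~ x) (p ^~ x)].
Proof.
have w0 x : X x -> 0 <= w x by have [_ + _] := dw; exact.
have /choice[q qP] := relaxes_pointwise_solution.
(* Freezing the curve at [p0] outside [X] makes [p 0 = p0] an equality of functions. *)
pose p (t : R) x := if `[< X x >] then q x t else p0 x.
have pq t x : X x -> p t x = q x t by rewrite /p; case: asboolP.
have dp x : X x -> relaxes alpha (Theta ^~ x) (p ^~ x).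
  move=> Xx t t0; rewrite [p t x]pq//.
  by apply: has_derivative_ge0_ext ((qP x Xx).2 t t0) => // s _; rewrite pq.
have p0E : p 0 = p0.
  by apply/funext => x; rewrite /p; case: asboolP => // Xx; rewrite (qP x Xx).1.
exists p; split => // t t0; apply: (density_fun_closed mX dw) => e e0.
have [->|tn0] := eqVneq t 0.
  by exists p0 => // x Xx; rewrite p0E subrr normr0 mulr_ge0 ?w0// ltW.
have [n ne] : exists n : nat, Lam * t / e < n.+1%:R.
  by exists (Num.truncn (Lam * t / e)); exact: truncnS_gt.
pose h := t / n.+1%:R.
have h0 : 0 <= h by rewrite divr_ge0.
have he : Lam * h <= e.
  by rewrite mulrA ler_pdivrMr// [leRHS]mulrC -ler_pdivrMr// ltW.
pose c := expR (- (alpha * h)).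
have c01 : 0 <= c <= 1.
  by rewrite expR_ge0/= -expR0 ler_expR oppr_le0 mulr_ge0// ltW.
suff [u du pu] : exists2 u, density_fun lam X u &
    forall x, X x -> `|p (n.+1%:R * h) x - u x| <= w x * (Lam * h).
  exists u => // x Xx; rewrite -(_ : n.+1%:R * h = t); last first.
    by rewrite mulrCA divff// mulr1.
  by rewrite (le_trans (pu _ Xx))// ler_wpM2l// w0.
(* In one grid step the inherited error is multiplied by [c] and the fresh one by [1 - c], so the
   same bound [w x * (Lam * h)] holds after any number of steps. *)
elim: n.+1 => [|k [u du pu]].
  by exists p0 => // x Xx; rewrite mul0r p0E subrr normr0 !mulr_ge0 ?w0.
have kh0 : 0 <= k%:R * h by rewrite mulr_ge0.
exists (fun x => c * u x + (1 - c) * Theta (k%:R * h) x).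
  by apply: density_fun_convex => //; exact: dTheta.
move=> x Xx.
have khS : k.+1%:R * h = k%:R * h + h by rewrite -natr1 mulrDl mul1r.
have : `|p (k.+1%:R * h) x - (c * p (k%:R * h) x +
    (1 - c) * Theta (k%:R * h) x)| <= (1 - c) * (w x * (Lam * h)).
  have := @relaxes_step _ _ alpha_gt0 _ _ (k%:R * h) (k.+1%:R * h)
    (Theta (k%:R * h) x) (w x * (Lam * h)) (dp x Xx) kh0.
  rewrite khS [X in alpha * X](_ : _ = h); last by ring.
  apply; first by rewrite lerDl.
  move=> s khs skh; rewrite (le_trans (Theta_lip _ _ _))//.
    exact: le_trans khs.
  by rewrite ler_wpM2l ?w0// ler_wpM2l// ger0_norm; lra.
have := pu x Xx; move: c01 => /andP[c0 c1].
set b := p (k%:R * h) x; set a := p _ x; set th := Theta _ _.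
set ee := w x * _ => bu ab; rewrite (_ : a - _ =
  (a - (c * b + (1 - c) * th)) + c * (b - u x)); last by ring.
rewrite (le_trans (ler_normD _ _))// normrM (ger0_norm c0).
have := ler_wpM2l c0 bu; lra.
Qed.

End density_relaxation.

(** * Picard iteration for response flows *)

Section response_dynamics.
Context d (T : measurableType d) (R : realType) (I : finType).
Variables (lam : {measure set T -> \bar R}) (X : I -> set T).
Hypothesis mX : forall i, measurable (X i).
Variables (alpha K L : R) (w : I -> T -> R).
Variable V : (I -> T -> R) -> I -> T -> R.
Implicit Types u v : I -> T -> R.

Definition densities u : Prop := forall i, density_fun lam (X i) (u i).

Definition profile_dist u v : R := \sum_i L1dist lam (X i) (u i) (v i).

Hypothesis alpha_gt0 : 0 < alpha.
Hypothesis K_ge1 : 1 <= K.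
Hypothesis L_ge0 : 0 <= L.
Hypothesis dw : densities w.
Hypothesis V_densities : forall u, densities u -> densities (V u).
Hypothesis V_le : forall u i x, densities u -> X i x -> V u i x <= w i x * K.
Hypothesis V_lip : forall u v i x, densities u -> densities v -> X i x ->
  `|V u i x - V v i x| <= w i x * (L * profile_dist u v).

Definition density_curve (U : R -> I -> T -> R) : Prop :=
  forall t, 0 <= t -> densities (U t).

Definition follows (Theta U : R -> I -> T -> R) : Prop :=
  forall i x, X i x -> relaxes alpha (fun t => Theta t i x) (fun t => U t i x).

Definition response_flow (U : R -> I -> T -> R) : Prop :=
  density_curve U /\ follows (fun t => V (U t)) U.

Let N : R := #|I|%:R.

(* The Bielecki rate: with the weight e^(kappa t) the Picard map contracts by
   the factor 1/2. *)
Let c : R := (2 * (N * L + 1))^-1.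
Definition response_rate : R := alpha / c.
Local Notation kappa := response_rate.

Let N_ge0 : 0 <= N. Proof. exact: ler0n. Qed.

Let sumN (k : R) : \sum_(i : I) k = N * k.
Proof. by rewrite sumr_const mulr_natl. Qed.

Let NL1 : 0 < N * L + 1. Proof. by rewrite ltr_wpDl// mulr_ge0. Qed.

Let c_gt0 : 0 < c. Proof. by rewrite invr_gt0 mulr_gt0. Qed.

(** The three factors of a Picard step: [N] passes from a weighted pointwise bound to the L^1
    distance of profiles, [L] to the distance of responses, and [c] is the gain of the relaxation.
    The summand 1 in [c] covers the case [L = 0]. *)
Let NLc : N * (L * c) <= 2^-1.
Proof.
rewrite mulrA /c invfM mulrCA -[leRHS]mulr1 ler_wpM2l ?invr_ge0//.
by rewrite ler_pdivrMr// mul1r lerDl.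
Qed.

Lemma response_rate_ge0 : 0 <= kappa.
Proof. by rewrite divr_ge0// ltW. Qed.

Let alpha_kappa : alpha <= c * (alpha + kappa).
Proof.
by rewrite mulrDr /kappa mulrCA divff ?lt0r_neq0// mulr1 lerDr mulr_ge0 ?ltW.
Qed.

Lemma profile_dist_ge0 u v : 0 <= profile_dist u v.
Proof. by apply: sumr_ge0 => i _; exact: L1dist_ge0. Qed.

Lemma profile_dist_le2 u v : densities u -> densities v ->
  profile_dist u v <= N * 2.
Proof.
move=> du dv; rewrite /profile_dist.
apply: (@le_trans _ _ (\sum_(i : I) 2)).
  by apply: ler_sum => i _; exact: L1dist_le2.
by rewrite sumN.
Qed.

Lemma profile_dist_le u v e (k : R) : densities e ->
  densities u -> densities v ->
  (forall i x, X i x -> `|u i x - v i x| <= e i x * k) ->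
  profile_dist u v <= N * k.
Proof.
move=> de du dv uv; apply: (@le_trans _ _ (\sum_(i : I) k)).
  by apply: ler_sum => i _; apply: (L1dist_le _ (de i)) => // x; exact: uv.
by rewrite sumN.
Qed.

Lemma densities_ge0 u i x : densities u -> X i x -> 0 <= u i x.
Proof. by move=> du; have [_ + _] := du i; exact. Qed.

Section envelope.
Variable u0 : I -> T -> R.
Hypothesis du0 : densities u0.

(* A probability density dominating, up to the factor [lip], the speed of any
   curve issued from u0 that relaxes to responses bounded by w * K. *)
Definition envelope i x : R := (1 + K)^-1 * u0 i x + (1 - (1 + K)^-1) * w i x.

Definition lip : R := (1 + K) * alpha.

Let K1 : 0 < 1 + K. Proof. by rewrite ltr_pwDl// (le_trans _ K_ge1). Qed.

Lemma lip_ge0 : 0 <= lip. Proof. by rewrite mulr_ge0 ?ltW. Qed.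

(** A curve relaxing from [u0] to responses below [w * K] stays below [u0 + w * K]; the envelope is
    this bound divided by its mass [1 + K]. *)
Lemma envelopeE i x : u0 i x + w i x * K = envelope i x * (1 + K).
Proof. by rewrite /envelope; field; exact: lt0r_neq0. Qed.

Lemma densities_envelope : densities envelope.
Proof.
move=> i; apply: density_fun_convex => //.
by rewrite invr_ge0 ltW// invf_le1// lerDl (le_trans _ K_ge1).
Qed.

Lemma follows_lipschitz Theta U : (forall i, U 0 i = u0 i) ->
  (forall t i x, 0 <= t -> X i x -> 0 <= Theta t i x <= w i x * K) ->
  follows Theta U ->
  forall s t i x, 0 <= s -> 0 <= t -> X i x ->
    `|U t i x - U s i x| <= envelope i x * (lip * `|t - s|).
Proof.
move=> U0 ThetaB UTheta s t i x s0 t0 Xx.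
have -> : envelope i x * (lip * `|t - s|) =
    (u0 i x + w i x * K) * (alpha * `|t - s|).
  by rewrite envelopeE /lip; ring.
rewrite -U0; apply: (relaxes_lipschitz alpha_gt0 (UTheta _ _ Xx)) => //.
  by rewrite U0 densities_ge0.
by move=> r r0; exact: ThetaB.
Qed.

(** The class preserved by the Picard map. Lipschitz continuity in time of a curve makes its
    response Lipschitz in time, as solving the next relaxation equation requires. *)
Definition admissible (U : R -> I -> T -> R) : Prop := density_curve U /\
  forall s t i x, 0 <= s -> 0 <= t -> X i x ->
    `|U t i x - U s i x| <= envelope i x * (lip * `|t - s|).

Definition follows_from (Theta U : R -> I -> T -> R) : Prop :=
  [/\ forall i, U 0 i = u0 i, density_curve U & follows Theta U].

Lemma admissible_dist U s t : admissible U -> 0 <= s -> 0 <= t ->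
  profile_dist (U t) (U s) <= N * (lip * `|t - s|).
Proof.
move=> [dU lipU] s0 t0; apply: (profile_dist_le densities_envelope).
- exact: dU.
- exact: dU.
- by move=> i x Xx; exact: lipU.
Qed.

Lemma exists_follows_from (Theta : R -> I -> T -> R) (Lam : R) : 0 <= Lam ->
  density_curve Theta ->
  (forall s t i x, 0 <= s -> 0 <= t -> X i x ->
    `|Theta t i x - Theta s i x| <= w i x * (Lam * `|t - s|)) ->
  exists U, follows_from Theta U.
Proof.
move=> Lam0 dTheta lipTheta.
have /choice[p pP] i : exists p : R -> T -> R,
    [/\ p 0 = u0 i, forall t, 0 <= t -> density_fun lam (X i) (p t)
      & forall x, X i x -> relaxes alpha (fun t => Theta t i x) (p ^~ x)].
  apply: (@density_relaxation _ _ _ _ _ (mX i) alpha Lam (w i) (u0 i)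
    (fun t => Theta t i)) => //.
    by move=> t t0; exact: dTheta.
  by move=> s t x s0 t0 Xx; exact: lipTheta.
exists (fun t i => p i t); split.
- by move=> i; have [] := pP i.
- by move=> t t0 i; have [_ + _] := pP i; exact.
- by move=> i x Xx; have [_ _] := pP i; exact.
Qed.

Lemma response_bounds U t i x : density_curve U -> 0 <= t -> X i x ->
  0 <= V (U t) i x <= w i x * K.
Proof.
move=> dU t0 Xx; rewrite V_le ?andbT//; last exact: dU.
by apply: densities_ge0 => //; apply: V_densities; exact: dU.
Qed.

Lemma exists_follows_response U : admissible U ->
  exists U', follows_from (fun t => V (U t)) U'.
Proof.
move=> aU; have [dU lipU] := aU.
apply: (@exists_follows_from _ (L * (N * lip))).
- by apply: mulr_ge0 => //; apply: mulr_ge0 => //; exact: lip_ge0.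
- by move=> t t0; apply: V_densities; exact: dU.
- move=> s t i x s0 t0 Xx; rewrite (le_trans (V_lip _ _ Xx))//; try exact: dU.
  rewrite ler_wpM2l ?densities_ge0//.
  by apply: le_trans (ler_wpM2l L_ge0 (admissible_dist aU s0 t0)) _;
    rewrite !mulrA.
Qed.

Lemma follows_response_admissible U U' : density_curve U ->
  follows_from (fun t => V (U t)) U' -> admissible U'.
Proof.
move=> dU [U0 dU' fU]; split=> //; apply: follows_lipschitz fU => //.
by move=> t i x t0 Xx; exact: response_bounds.
Qed.

(** The weighted Bielecki distance is at most [M], stated as a bound so that no supremum has to be
    finite. *)
Definition close (M : R) (U U' : R -> I -> T -> R) : Prop :=
  forall t i x, 0 <= t -> X i x ->
    `|U t i x - U' t i x| <= w i x * (M * expR (kappa * t)).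

Lemma follows_response_contraction M U1 U2 U1' U2' : 0 <= M ->
  density_curve U1 -> density_curve U2 ->
  follows_from (fun t => V (U1 t)) U1' ->
  follows_from (fun t => V (U2 t)) U2' ->
  close M U1 U2 -> close (2^-1 * M) U1' U2'.
Proof.
move=> M0 dU1 dU2 [U10 _ fU1] [U20 _ fU2] U12 t i x t0 Xx.
have w0 := densities_ge0 dw Xx.
have : `|U1' t i x - U2' t i x -
    expR (- (alpha * t)) * (U1' 0 i x - U2' 0 i x)| <=
    c * (w i x * (L * (N * M))) * expR (kappa * t).
  apply: (relaxes_expR_bound alpha_gt0 (relaxesB (fU1 i x Xx) (fU2 i x Xx))) =>
    //.
  - by rewrite !mulr_ge0.
  - exact: response_rate_ge0.
  - move=> s s0; apply: le_trans (V_lip (dU1 _ s0) (dU2 _ s0) Xx) _.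
    rewrite -[leRHS]mulrA ler_wpM2l// -[leRHS]mulrA ler_wpM2l// -[leRHS]mulrA.
    apply: (profile_dist_le dw); [exact: dU1|exact: dU2|].
    by move=> j y Xy; exact: U12.
rewrite U10 U20 subrr mulr0 subr0 => /le_trans; apply.
rewrite (_ : c * _ * _ =
  w i x * (N * (L * c) * (M * expR (kappa * t)))); last by ring.
by rewrite ler_wpM2l// -[leRHS]mulrA ler_wpM2r// mulr_ge0// expR_ge0.
Qed.

Lemma exists_response_flow :
  exists U, response_flow U /\ forall i, U 0 i = u0 i.
Proof.
(* The iteration starts from the relaxation of [u0] towards the constant response [w], which has
   Lipschitz constant 0 in time. *)
have [U0 U0P] : exists U, follows_from (fun=> w) U.
  apply: (@exists_follows_from _ 0) => // s t i x _ _ Xx.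
  by rewrite subrr normr0 mul0r mulr0.
have aU0 : admissible U0.
  have [U00 dU0 fU0] := U0P; split => //; apply: follows_lipschitz fU0 => //.
  by move=> t i x _ Xx; rewrite densities_ge0//= ler_peMr// densities_ge0.
(* Choice turns the Picard map into a total function; only its values on admissible curves are
   specified. *)
have /choice[F FP] U : exists U',
    admissible U -> follows_from (fun t => V (U t)) U'.
  have [/exists_follows_response[U' U'P]|nU] := pselect (admissible U).
    by exists U'.
  by exists U0.
have aF U : admissible U -> admissible (F U).
  by move=> aU; apply: follows_response_admissible (FP _ aU); exact: aU.1.
pose Un n := iter n F U0.
have aUn n : admissible (Un n) by elim: n => //= n; exact: aF.
have clUn n : close (K * 2^-1 ^+ n) (Un n.+1) (Un n).
  elim: n => [|n IH]; last first.
    rewrite exprS mulrCA.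
    apply: (follows_response_contraction _ _ _ (FP _ (aUn n.+1)) (FP _ (aUn n))
      IH).
    - by rewrite mulr_ge0 ?exprn_ge0 ?invr_ge0// (le_trans _ K_ge1).
    - exact: (aUn n.+1).1.
    - exact: (aUn n).1.
  (* The first two iterates relax to [w] and to [V (U0 s)]. Both lie between 0 and [w * K], the
     former because [K >= 1], so these forcings differ by at most [w * K]. *)
  move=> t i x t0 Xx; rewrite expr0 mulr1 /=.
  have w0 := densities_ge0 dw Xx.
  have [F00 dF0 fF0] := FP _ aU0; have [U00 dU0 fU0] := U0P.
  have : `|F U0 t i x - U0 t i x - expR (- (alpha * t)) * (F U0 0 i x - U0 0 i
    x)|
      <= 1 * (w i x * K) * expR (kappa * t); last first.
    by rewrite F00 U00 subrr mulr0 subr0 mul1r mulrA.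
  apply: (relaxes_expR_bound alpha_gt0 (relaxesB (fF0 i x Xx) (fU0 i x Xx))) =>
    //.
  - by rewrite mulr_ge0// (le_trans _ K_ge1).
  - exact: response_rate_ge0.
  - by rewrite mul1r lerDl response_rate_ge0.
  - move=> s s0; apply: (@le_trans _ _ (w i x * K)).
      have /andP[V0 VK] := response_bounds dU0 s0 Xx.
      have wK : w i x <= w i x * K by rewrite ler_peMr.
      by rewrite ler_norml; apply/andP; split; lra.
    rewrite ler_peMr//; first by rewrite mulr_ge0// (le_trans _ K_ge1).
    by rewrite -expR0 ler_expR mulr_ge0// response_rate_ge0.
have /choice[U UP] (tix : R * I * T) : exists l : R,
    0 <= tix.1.1 -> X tix.1.2 tix.2 -> forall n,
    `|l - Un n tix.1.1 tix.1.2 tix.2| <=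
      w tix.1.2 tix.2 * (2 * K * 2^-1 ^+ n * expR (kappa * tix.1.1)).
  case: tix => -[t i] x /=.
  have [[t0 Xx]|nP] := pselect (0 <= t /\ X i x); last first.
    by exists 0 => t0 Xx; case: nP.
  have /geometric_cauchy_limit[l lP] : forall n,
    `|Un n.+1 t i x - Un n t i x| <=
      w i x * (K * expR (kappa * t)) * 2^-1 ^+ n.
    move=> n; apply: le_trans (clUn n t i x t0 Xx) _; rewrite le_eqVlt.
    by apply/orP; left; apply/eqP; ring.
  exists l => _ _ n; apply: le_trans (lP n) _; rewrite le_eqVlt; apply/orP;
    left.
  by apply/eqP; ring.
pose W t i x := U (t, i, x).
have clW n : close (2 * K * 2^-1 ^+ n) W (Un n).
  by move=> t i x t0 Xx; exact: UP (t, i, x) t0 Xx n.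
have dW : density_curve W.
  move=> t t0 i; apply: (density_fun_closed (mX i) (dw i)) => e e0.
  have [n ne] := exists_geometric_le (2 * K * expR (kappa * t)) e0.
  exists (Un n t i) => [|x Xx]; first exact: (aUn n).1.
  apply: le_trans (clW n t i x t0 Xx) _.
  by rewrite ler_wpM2l ?densities_ge0// mulrAC.
have aW : admissible W.
  split=> // s t i x s0 t0 Xx; apply/ler_addgt0Pr => e e0.
  have [n] := exists_geometric_le
    (w i x * (2 * K * (expR (kappa * t) + expR (kappa * s)))) e0.
  have := clW n t i x t0 Xx; have := clW n s i x s0 Xx.
  have := (aUn n).2 s t i x s0 t0 Xx.
  rewrite !ler_norml => /andP[? ?] /andP[? ?] /andP[? ?] ?.
  by apply/andP; split; lra.
(* Both [F W] and [W] are close to [Un n.+1], by contraction and by construction, with errors that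
   vanish as [n] grows. *)
have FW t i x : 0 <= t -> X i x -> F W t i x = W t i x.
  move=> t0 Xx; apply/eqP; rewrite -subr_eq0 -normr_le0.
  apply/ler_addgt0Pr => e e0; rewrite add0r.
  have [n ne] := exists_geometric_le (w i x * (2 * K * expR (kappa * t))) e0.
  have K0 : 0 <= 2 * K * 2^-1 ^+ n.
    by rewrite !mulr_ge0 ?exprn_ge0 ?invr_ge0// (le_trans _ K_ge1).
  have : `|F W t i x - Un n.+1 t i x| <= _ := follows_response_contraction K0 dW
    (aUn n).1 (FP _ aW) (FP _ (aUn n)) (clW n) t0 Xx.
  have := clW n.+1 t i x t0 Xx; rewrite exprS.
  rewrite !ler_norml => /andP[? ?] /andP[? ?].
  by apply/andP; split; lra.
(* The flow returned is [F W]: it starts at [u0] as a function, whereas [W] is controlled only on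
   [X]. The two are at L^1 distance 0 for nonnegative times, hence have the same response. *)
have [FW0 dFW fFW] := FP _ aW; exists (F W); split=> //; split=> // i x Xx t t0.
have -> : V (F W t) i x = V (W t) i x; last exact: fFW.
apply/eqP; rewrite -subr_eq0 -normr_le0.
apply: le_trans (V_lip (dFW _ t0) (dW _ t0) Xx) _.
have -> : profile_dist (F W t) (W t) = 0; last by rewrite !mulr0.
apply/le_anti; rewrite profile_dist_ge0 andbT -(mulr0 N).
apply: (profile_dist_le dw); [exact: dFW|exact: dW|].
by move=> j y Xy; rewrite FW// subrr normr0 mulr0.
Qed.

End envelope.

(* Gronwall without an integral: bounding the supremum of
   [expR (- kappa t) * dist] by its initial value plus half of itself. *)
Lemma response_flow_stable U1 U2 : response_flow U1 -> response_flow U2 ->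
  forall t, 0 <= t -> profile_dist (U1 t) (U2 t) <=
    2 * profile_dist (U1 0) (U2 0) * expR (kappa * t).
Proof.
move=> [dU1 fU1] [dU2 fU2].
set S0 := profile_dist (U1 0) (U2 0).
have half A : 0 <= A -> (forall t, 0 <= t ->
      profile_dist (U1 t) (U2 t) <= A * expR (kappa * t)) ->
    forall t, 0 <= t ->
      profile_dist (U1 t) (U2 t) <= (S0 + 2^-1 * A) * expR (kappa * t).
  move=> A0 SA t t0.
  have E1 : 1 <= expR (kappa * t).
    by rewrite -expR0 ler_expR mulr_ge0// response_rate_ge0.
  have E0 := ltW (lt_le_trans ltr01 E1).
  apply: (@le_trans _ _ (\sum_i (L1dist lam (X i) (U1 0 i) (U2 0 i) +
      c * (L * A) * expR (kappa * t)))).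
    apply: ler_sum => i _.
    apply: (L1dist_le_add (mX i) (dw i)) => //;
      [exact: dU1|exact: dU2|exact: dU1|exact: dU2|].
    move=> x Xx; have w0 := densities_ge0 dw Xx.
    have : `|U1 t i x - U2 t i x -
        expR (- (alpha * t)) * (U1 0 i x - U2 0 i x)| <=
        c * (w i x * (L * A)) * expR (kappa * t).
      apply: (relaxes_expR_bound alpha_gt0
        (relaxesB (fU1 i x Xx) (fU2 i x Xx))) => //.
      - by rewrite !mulr_ge0.
      - exact: response_rate_ge0.
      - move=> s s0; apply: le_trans (V_lip (dU1 _ s0) (dU2 _ s0) Xx) _.
        rewrite -[leRHS]mulrA ler_wpM2l// -[leRHS]mulrA ler_wpM2l//.
        exact: SA.
    have -> : w i x * (c * (L * A) * expR (kappa * t)) =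
      c * (w i x * (L * A)) * expR (kappa * t) by ring.
    set a := U1 t i x - _; set b := U1 0 i x - _ => ab.
    have : `|expR (- (alpha * t)) * b| <= `|b|.
      rewrite normrM ger0_norm ?expR_ge0// ler_piMl//.
      by rewrite -expR0 ler_expR oppr_le0 mulr_ge0// ltW.
    by have := ler_normD (a - expR (- (alpha * t)) * b)
      (expR (- (alpha * t)) * b); rewrite subrK; lra.
  rewrite big_split/= sumN -/S0 mulrDl lerD//.
    by rewrite ler_peMr// profile_dist_ge0.
  rewrite (_ : N * _ = N * (L * c) * A * expR (kappa * t)).
    by rewrite ler_wpM2r// ler_wpM2r.
  by ring.
pose E := [set expR (- (kappa * t)) * profile_dist (U1 t) (U2 t) | t in [set t
  | 0 <= t]].
have EubP A t : (expR (- (kappa * t)) * profile_dist (U1 t) (U2 t) <= A) =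
    (profile_dist (U1 t) (U2 t) <= A * expR (kappa * t)).
  by rewrite expRN mulrC ler_pdivrMr// expR_gt0.
have E0 : E !=set0 by exists (expR (- (kappa * 0)) * S0); exists 0 => /=.
(* Densities are at L^1 distance at most 2, so the supremum is finite a priori and half of it can be
   absorbed; this absorption produces the factor 2 of the estimate. *)
have Eub : has_sup E.
  split=> //; exists (N * 2) => _ [t /= t0 <-].
  rewrite -[leRHS]mul1r ler_pM ?expR_ge0 ?profile_dist_ge0//.
    by rewrite -expR0 ler_expR oppr_le0 mulr_ge0// response_rate_ge0.
  by apply: profile_dist_le2; [exact: dU1|exact: dU2].
have supE t : 0 <= t -> profile_dist (U1 t) (U2 t) <= sup E * expR (kappa * t).
  by move=> t0; rewrite -EubP; apply: sup_upper_bound => //; exists t.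
have sup0 : 0 <= sup E.
  apply: le_trans (sup_upper_bound Eub (_ : E (expR (- (kappa * 0)) * S0))).
    by rewrite mulr_ge0 ?expR_ge0 ?profile_dist_ge0.
  by exists 0 => /=.
have : sup E <= S0 + 2^-1 * sup E.
  by apply: ge_sup => // _ [t /= t0 <-]; rewrite EubP; exact: half.
move=> supS t t0; apply: le_trans (supE t t0) _.
by rewrite ler_wpM2r ?expR_ge0//; lra.
Qed.

Definition velocity (U : R -> I -> T -> R) t i x : R :=
  alpha * (V (U t) i x - U t i x).

Lemma response_flow_lipschitz U : response_flow U ->
  exists g (C : R), [/\ densities g,
    forall s t i x, 0 <= s -> 0 <= t -> X i x ->
      `|U t i x - U s i x| <= g i x * (C * `|t - s|)
  & forall s t i x, 0 <= s -> 0 <= t -> X i x ->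
      `|velocity U t i x - velocity U s i x| <= g i x * (C * `|t - s|)].
Proof.
move=> [dU fU]; have dU0 := dU _ (lexx 0); set e := envelope (U 0).
have aU : admissible (U 0) U.
  split=> //; apply: follows_lipschitz fU => // t i x t0 Xx.
  exact: response_bounds.
have de : densities e by exact: densities_envelope.
have l0 := lip_ge0.
(* Increments of the response are dominated through [w], those of the state through [e]; their
   average is one density that controls both up to a factor 2. *)
pose g i x := 2^-1 * w i x + (1 - 2^-1) * e i x.
have dg : densities g.
  move=> i; apply: density_fun_convex => //.
  by rewrite invr_ge0 ler0n invf_le1// ler1n.
have L2 : 0 <= L * (N * lip) by apply: mulr_ge0 => //; exact: mulr_ge0.
have L3 : 0 <= alpha * (L * (N * lip) + lip).
  by apply: mulr_ge0; [exact: ltW|exact: addr_ge0].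
have wg i x : X i x -> w i x <= g i x * 2 /\ e i x <= g i x * 2.
  move=> Xx; have := densities_ge0 dw Xx; have := densities_ge0 de Xx.
  by rewrite /g; move: (w i x) (e i x) => ? ? ? ?; split; lra.
exists g, (2 * (lip + alpha * (L * (N * lip) + lip))); split => //.
  move=> s t i x s0 t0 Xx; apply: le_trans (aU.2 s t i x s0 t0 Xx) _.
  have [_ eg] := wg _ _ Xx; set r := `|t - s|;
    have r0 : 0 <= r by exact: normr_ge0.
  have g0 : 0 <= g i x * 2 by apply: le_trans eg; exact: densities_ge0 de Xx.
  rewrite (_ : g i x * _ = g i x * 2 * (lip * r) +
    g i x * 2 * (alpha * (L * (N * lip) + lip) * r)); last by ring.
  apply: ler_wpDr; first by apply: mulr_ge0 => //; exact: mulr_ge0.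
  by apply: ler_wpM2r => //; exact: mulr_ge0.
move=> s t i x s0 t0 Xx; have [wg2 eg2] := wg _ _ Xx.
have w0 := densities_ge0 dw Xx; set r := `|t - s|.
have r0 : 0 <= r by exact: normr_ge0.
have VU : `|V (U t) i x - V (U s) i x| <= w i x * (L * (N * lip) * r).
  apply: le_trans (V_lip (dU _ t0) (dU _ s0) Xx) _; apply: ler_wpM2l => //.
  by have := ler_wpM2l L_ge0 (admissible_dist dU0 aU s0 t0); rewrite !mulrA.
have VU2 : `|V (U t) i x - V (U s) i x| <= g i x * 2 * (L * (N * lip) * r).
  by apply: le_trans VU _; apply: ler_wpM2r => //; exact: mulr_ge0.
have eU : `|U t i x - U s i x| <= g i x * 2 * (lip * r).
  apply: le_trans (aU.2 s t i x s0 t0 Xx) _.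
  by apply: ler_wpM2r => //; exact: mulr_ge0.
have g0 : 0 <= g i x * 2 * (lip * r).
  by apply: mulr_ge0; [exact: le_trans wg2|exact: mulr_ge0].
have := ler_normB (V (U t) i x - V (U s) i x) (U t i x - U s i x).
have -> : V (U t) i x - V (U s) i x - (U t i x - U s i x) =
  (V (U t) i x - U t i x) - (V (U s) i x - U s i x) by ring.
move=> VUB; rewrite /velocity -mulrBr normrM (gtr0_norm alpha_gt0).
rewrite (_ : g i x * _ = g i x * 2 * (lip * r) + alpha *
  (g i x * 2 * (L * (N * lip) * r) + g i x * 2 * (lip * r))); last by ring.
apply: ler_wpDl => //; apply: ler_wpM2l; first exact: ltW.
by apply: le_trans VUB _; exact: lerD.
Qed.

End response_dynamics.

(** * Densities and probability measures *)

Section measure_of_density.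
Context {R : realType} {d : nat} (X : set 'rV[R]_d) (p : 'rV[R]_d -> R).
Hypothesis mX : measurable X.
Hypothesis dp : density_fun (lebesgue_rV R d) X p.

Definition density_measure (A : set 'rV[R]_d) : \bar R :=
  (\int[lebesgue_rV R d]_(x in A `&` X) (p x)%:E)%E.

Let density_measure0 : density_measure set0 = 0%E.
Proof. by rewrite /density_measure set0I integral_set0. Qed.

Let density_measure_ge0 A : (0 <= density_measure A)%E.
Proof.
by apply: integral_ge0 => x [_ Xx]; rewrite lee_fin; have [_ + _] := dp; exact.
Qed.

Let density_measure_sigma_additive : semi_sigma_additive density_measure.
Proof.
have [mp p0 _] := dp => F mF tF mUF.
have -> : density_measure (\bigcup_n F n) =
    (\sum_(n <oo) density_measure (F n))%E.
  rewrite /density_measure setI_bigcupl ge0_integral_bigcup//.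
  - by move=> k; exact: measurableI.
  - apply/measurable_EFinP; apply: measurable_funS mp => //.
    by move=> x [k _ []].
  - by move=> x [k _ [_ Xx]]; rewrite lee_fin p0.
  - exact: trivIset_setIr.
exact: is_cvg_nneseries.
Qed.

HB.instance Definition _ := isMeasure.Build _ _ _ density_measure
  density_measure0 density_measure_ge0 density_measure_sigma_additive.

Let density_measureT : density_measure setT = 1%E.
Proof. by rewrite /density_measure setTI; have [_ _] := dp. Qed.

HB.instance Definition _ :=
  Measure_isProbability.Build _ _ _ density_measure density_measureT.

Let density_measureX : density_measure X = 1%E.
Proof. by rewrite /density_measure setIid; have [_ _] := dp. Qed.

Definition prob_of_density : prob_on X := ProbOn density_measureX.

Lemma is_density_prob_of_density : is_density prob_of_density p.
Proof. by have [mp p0 _] := dp; split. Qed.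

End measure_of_density.

Section prob_on_densities.
Context {R : realType} {d : nat} (X : set 'rV[R]_d).
Hypothesis mX : measurable X.
Local Notation lam := (lebesgue_rV R d).
Local Notation dist := (L1dist lam X).
Implicit Types P Q : prob_on X.

Lemma is_density_density_fun P p : is_density P p -> density_fun lam X p.
Proof.
move=> [mp p0 PE]; split => //.
by have := PE _ mX; rewrite setIid prob_on_full.
Qed.

Lemma prob_on_setIX P A : measurable A -> P (A `&` X) = P A.
Proof.
move=> mA; rewrite [RHS](measureDI P mA mX) [X in (X + _)%E](_ : _ = 0%E)
  ?add0e//.
apply/eqP; rewrite eq_le measure_ge0 andbT.
have PC : P (~` X) = 0%E.
  by rewrite probability_setC// [P X]prob_on_full subee.
by rewrite -PC le_measure ?inE//; [exact: measurableD|exact: measurableC].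
Qed.

Lemma abs_cont_density P : abs_cont P -> exists p, is_density P p.
Proof.
move=> /radon_nikodym_sigma_finite[f [f0 ffin fi fE]].
exists (fine \o f); split.
- apply: measurableT_comp => //.
  exact: measurable_funTS (measurable_int _ fi).
- by move=> x _; exact: fine_ge0.
- move=> A mA; rewrite -prob_on_setIX// [LHS]fE; last exact: measurableI.
  by apply: eq_integral => x _; rewrite /= fineK.
Qed.

Lemma density_abs_cont P p : is_density P p -> abs_cont P.
Proof.
move=> [mp p0 PE]; apply/null_content_dominatesP => A mA A0.
have mAX : measurable (A `&` X) by exact: measurableI.
rewrite PE//; apply: null_set_integral => //.
  by apply/measurable_EFinP; exact: measurable_funS mp.
by apply/eqP; rewrite -measure_le0 -A0 le_measure// inE.
Qed.

Lemma is_density_same P Q p : is_density P p -> is_density Q p ->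
  measure_same P Q.
Proof. by move=> [_ _ PE] [_ _ QE] A mA; rewrite PE// QE. Qed.

Lemma has_sup_TV P Q :
  has_sup [set `|fine (P A) - fine (Q A)| | A in measurable].
Proof.
split; first by exists `|fine (P set0) - fine (Q set0)|; exists set0.
exists 1 => _ [A mA <-].
have fin01 (P' : prob_on X) : 0 <= fine (P' A) <= 1.
  by rewrite fine_ge0//= -lee_fin fineK ?fin_num_measure// probability_le1.
have := fin01 P; have := fin01 Q; move: (fine (P A)) (fine (Q A)) => a b.
by move=> /andP[? ?] /andP[? ?]; rewrite ler_norml; apply/andP; split; lra.
Qed.

Lemma TV_ge P Q A : measurable A -> `|fine (P A) - fine (Q A)| <= TV P Q.
Proof. by move=> mA; apply: sup_upper_bound; [exact: has_sup_TV|exists A]. Qed.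

Lemma TV_le0_same P Q : TV P Q <= 0 -> measure_same P Q.
Proof.
move=> PQ0 A mA; have := le_trans (TV_ge P Q mA) PQ0.
rewrite normr_le0 subr_eq0 => /eqP PQA.
by rewrite -[LHS]fineK ?fin_num_measure// PQA fineK ?fin_num_measure.
Qed.

Lemma density_fine P p A : is_density P p -> measurable A ->
  fine (P A) = \int[lam]_(x in A `&` X) p x.
Proof. by move=> [_ _ PE] mA; rewrite PE. Qed.

(** Integrating over all of [X] costs a factor 2 against the exact value [L1dist / 2], which is
    harmless for continuity and uniqueness. *)
Lemma TV_le_L1dist P Q p q : is_density P p -> is_density Q q ->
  TV P Q <= dist p q.
Proof.
move=> dP dQ; have dp := is_density_density_fun dP.
have dq := is_density_density_fun dQ.
apply: ge_sup; first exact: (has_sup_TV P Q).1.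
move=> _ [A mA <-]; have mAX : measurable (A `&` X) by exact: measurableI.
have AX : A `&` X `<=` X by [].
have ip := integrableS mX mAX AX (density_fun_integrable dp).
have iq := integrableS mX mAX AX (density_fun_integrable dq).
rewrite (density_fine dP)// (density_fine dQ)// -RintegralB//.
apply: le_trans (le_normr_Rintegral mAX _) _.
  by have := integrableB mAX ip iq; exact: eq_integrable.
have ipq := L1dist_integrable mX dp dq.
rewrite /L1dist /Rintegral fine_le//.
- apply: integrable_fin_num => //.
  exact: integrableS ipq.
- exact: integrable_fin_num.
- by apply: ge0_subset_integral => //; exact: measurable_int ipq.
Qed.

(** The difference [p - q] has constant sign on [A] and on [B], so each partial integral is a
    difference of measures of one set, hence at most the total variation. *)
Lemma L1dist_le_TV P Q p q : is_density P p -> is_density Q q ->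
  dist p q <= 2 * TV P Q.
Proof.
move=> dP dQ; have dp := is_density_density_fun dP.
have dq := is_density_density_fun dQ.
have [[mp _ _] [mq _ _]] := (dp, dq).
pose A := X `&` [set x | q x <= p x]; pose B := X `\` A.
have mA : measurable A.
  exact: (measurable_fun_ler mq mp mX (_ : measurable [set true])).
have mB : measurable B by exact: measurableD.
have AX : A `<=` X by move=> x [].
have ABX : A `|` B = X by exact: setDUK.
have half P1 P2 p1 p2 C : is_density P1 p1 -> is_density P2 p2 ->
    measurable C -> C `<=` X -> (forall x, C x -> p2 x <= p1 x) ->
    \int[lam]_(x in C) `|p1 x - p2 x| <= `|fine (P1 C) - fine (P2 C)|.
  move=> dP1 dP2 mC CX p12; rewrite (density_fine dP1)// (density_fine dP2)//.
  rewrite (setIidl CX) -RintegralB//; last 2 first.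
  - exact: integrableS mX mC CX (density_fun_integrable (is_density_density_fun
    dP1)).
  - exact: integrableS mX mC CX (density_fun_integrable (is_density_density_fun
    dP2)).
  rewrite [leLHS](_ : _ = \int[lam]_(x in C) (p1 x - p2 x)) ?ler_norm//.
  apply: eq_Rintegral => x /[!inE] Cx.
  by rewrite ger0_norm// subr_ge0 p12.
rewrite /L1dist -[X in \int[_]_(_ in X) _]ABX Rintegral_setU//; last 2 first.
- by rewrite ABX; exact: L1dist_integrable.
- by apply/disj_setPS => x [Ax [_ nAx]].
rewrite mulrDl !mul1r lerD//.
  by apply: le_trans (half P Q p q A _ _ _ _ _) _ => // [x []//|]; exact: TV_ge.
rewrite (@eq_Rintegral _ _ _ _ _ (fun x => `|q x - p x|)); last first.
  by move=> x _; rewrite distrC.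
apply: le_trans (half Q P q p B _ _ _ _ _) _ => // [x [] //|x [Xx nAx]|].
  by rewrite leNgt; apply/negP => /ltW pq; apply: nAx.
by rewrite distrC; exact: TV_ge.
Qed.

(* Radon-Nikodym identifies the density with the derivative dP/dlam almost
   everywhere, which gives the change of variables. *)
Lemma Rintegral_is_density P p (f : 'rV[R]_d -> R) (C : R) : is_density P p ->
  measurable_fun X f -> (forall x, X x -> `|f x| <= C) ->
  \int[P]_(x in X) f x = \int[lam]_(x in X) (f x * p x).
Proof.
move=> dP mf fC; have dp := is_density_density_fun dP; have [mp p0 PE] := dP.
have Plam := density_abs_cont dP.
have fi : P.-integrable X (EFin \o f).
  apply: measurable_bounded_integrable => //.
    exact: le_lt_trans (probability_le1 P mX) (ltry _).
  exists C; split; first exact: num_real.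
  by move=> c Cc x Xx; exact: le_trans (fC _ Xx) (ltW Cc).
rewrite /Rintegral -(Radon_Nikodym_change_of_variables Plam mX fi).
congr fine; apply: ae_eq_integral => //.
- apply: emeasurable_funM; first exact/measurable_EFinP.
  exact: measurable_funTS.
- by apply/measurable_EFinP; exact: measurable_funM.
apply: (@ae_eqe_mul2l _ _ _ _ _ _ (EFin \o p) (EFin \o f)).
apply: ae_eq_sym; apply: integral_ae_eq => //.
- exact: density_fun_integrable.
- exact: measurable_funTS.
- by move=> E EX mE; rewrite -Radon_Nikodym_integral// [RHS]PE// (setIidl EX).
Qed.

End prob_on_densities.

(** * Lipschitz estimates for the best responses *)

Lemma normr_Rintegral_le_bound d (T : measurableType d) (R : realType)
    (mu : {measure set T -> \bar R}) (A : set T) (f : T -> R) (k : R) :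
  measurable A -> (mu A < +oo)%E -> mu.-integrable A (EFin \o f) ->
  (forall x, A x -> `|f x| <= k) ->
  `|\int[mu]_(x in A) f x| <= k * fine (mu A).
Proof.
move=> mA Aoo fi fk; apply: le_trans (le_normr_Rintegral mA fi) _.
rewrite -Rintegral_cst//; apply: le_Rintegral => //.
  exact: integrable_norm.
apply/integrableP; split; first exact/measurable_EFinP.
by rewrite integral_cst// lte_mul_pinfty// ?lee_fin.
Qed.

Section flat_derivative_lipschitz.
Context {R : realType} {d : nat} (X : set 'rV[R]_d).
Hypothesis mX : measurable X.
Local Notation lam := (lebesgue_rV R d).

Lemma within_continuous_measurable_rV (f : 'rV[R]_d -> R) :
  {within X, continuous f} -> measurable_fun X f.
Proof.
move=> /continuousP cf.
have open_preimage (V : set (subspace X)) : open V -> measurable (X `&` V).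
  move=> /open_subspaceP[V' oV' VX]; rewrite setIC -VX;
    apply: measurableI => //.
  exact: sub_sigma_algebra.
apply: (@measurability _ _ _ _ _ _ _ (RGenOpens.measurableE R)).
move=> _ [_ [a [b ->]] <-].
by apply: open_preimage; apply: cf; exact: interval_open.
Qed.

Lemma is_flat_derivative_measurable (G : prob_on X -> R) D P :
  is_flat_derivative G D -> measurable_fun X (D P).
Proof.
move=> [cD _ _ _]; apply: within_continuous_measurable_rV.
apply/subspace_continuousP => x Xx.
have := (subspace_continuousP _ _).1 cD (P, x) (conj I Xx).
apply: cvg_trans => A /=; rewrite /within/= !nbhs_simpl/=.
move=> [[A1 A2]/= [A1P A2x] A12].
apply: filterS A2x => y A2y Xy.
by apply: (A12 (P, y)) => //; split => //; exact: nbhs_singleton.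
Qed.

Variables (G : prob_on X -> R) (D : prob_on X -> 'rV[R]_d -> R) (C : R).
Hypothesis GD : is_flat_derivative G D.
Hypothesis DC : forall P x, X x -> `|D P x| <= C.

(** The mixture enters only through the integrand, which is bounded by [C]; the integrating measures
    are [P] and [Q], whose densities are at hand. *)
Lemma flat_integrand_le P Q p q (e : R) : is_density P p -> is_density Q q ->
  `|flat_integrand D P Q e| <= C * L1dist lam X q p.
Proof.
move=> dP dQ; rewrite /flat_integrand.
set f := D _.
have mf : measurable_fun X f := is_flat_derivative_measurable _ GD.
have fC x : X x -> `|f x| <= C by exact: DC.
rewrite (Rintegral_is_density mX dQ mf fC) (Rintegral_is_density mX dP mf fC).
have dp := is_density_density_fun mX dP;
  have dq := is_density_density_fun mX dQ.
have bounded_mul r : density_fun lam X r ->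
    lam.-integrable X (EFin \o (fun x => f x * r x)).
  move=> dr; have [mr r0 _] := dr.
  have iCr : lam.-integrable X (EFin \o (fun x => C * r x)).
    by have := integrableZl mX C (density_fun_integrable dr);
      exact: eq_integrable.
  apply: le_integrable iCr => //.
    by apply/measurable_EFinP; exact: measurable_funM.
  move=> x Xx; rewrite /= lee_fin !normrM ler_wpM2r//.
  exact: le_trans (fC _ Xx) (ler_norm _).
have ip := bounded_mul _ dp; have iq := bounded_mul _ dq.
rewrite -RintegralB//.
apply: le_trans (le_normr_Rintegral mX _) _.
  by have := integrableB mX iq ip; exact: eq_integrable.
have iqp := L1dist_integrable mX dq dp.
rewrite /L1dist -RintegralZl//; apply: le_Rintegral => //.
- by have := integrable_norm (integrableB mX iq ip); exact: eq_integrable.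
- by have := integrableZl mX C iqp; exact: eq_integrable.
- by move=> x Xx; rewrite -mulrBr normrM ler_wpM2r// fC.
Qed.

Lemma flat_derivative_lipschitz P Q p q : is_density P p -> is_density Q q ->
  `|G Q - G P| <= C * L1dist lam X q p.
Proof.
move=> dP dQ; have [_ _ /(_ P Q)[ih ->] _] := GD.
have mu01 : fine (@lebesgue_measure R `[0, 1]%classic) = 1.
  by rewrite lebesgue_measure_itv/= lte_fin ltr01 oppr0 adde0.
have := normr_Rintegral_le_bound (k := C * L1dist lam X q p) _ _ ih.
rewrite [fine _]mu01 mulr1; apply => //.
  by rewrite [X in (X < _)%E](lebesgue_measure_itv `[0,
    1])/= lte_fin ltr01 ltry.
by move=> e _; exact: flat_integrand_le.
Qed.

End flat_derivative_lipschitz.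

(** * Gibbs densities with bounded potentials *)

Section normalized_exp_bounds.
Context {R : realType} {d : nat} (X : set 'rV[R]_d) (U : 'rV[R]_d -> R).
Hypothesis mX : measurable X.
Hypothesis mU : measurable_fun X U.
Local Notation lam := (lebesgue_rV R d).
Local Notation w := (fun x => expR (- U x)).
Hypothesis U1 : (\int[lam]_(x in X) (w x)%:E = 1)%E.
Variable B : R.

Let dw : density_fun lam X w.
Proof.
split => //.
by apply: measurableT_comp => //; exact: measurable_funN.
Qed.

Local Notation gibbs f := (normalized_exp X (fun x => f x - U x)).

Definition bounded_potential (f : 'rV[R]_d -> R) : Prop :=
  measurable_fun X f /\ forall x, X x -> `|f x| <= B.

Lemma expR_potentialE f x : expR (f x - U x) = expR (f x) * w x.
Proof. by rewrite expRD. Qed.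

Definition partition_fun f : R := \int[lam]_(x in X) expR (f x - U x).

Lemma integrable_potential f : bounded_potential f ->
  lam.-integrable X (EFin \o (fun x => expR (f x - U x))).
Proof.
move=> [mf fB].
have iw : lam.-integrable X (EFin \o (fun x => expR B * w x)).
  by have := integrableZl mX (expR B) (density_fun_integrable dw);
    exact: eq_integrable.
apply: le_integrable iw => //.
  apply/measurable_EFinP; apply: measurableT_comp => //.
  exact: measurable_funB.
move=> x Xx; rewrite /= lee_fin expR_potentialE !normrM ler_wpM2r//.
rewrite !ger0_norm ?expR_ge0// ler_expR.
exact: le_trans (ler_norm _) (fB _ Xx).
Qed.

Lemma partition_fun_ge f : bounded_potential f -> expR (- B) <= partition_fun f.
Proof.
move=> bf; have iw := density_fun_integrable dw.
rewrite -[leLHS]mulr1 -(density_fun_Rintegral dw) -RintegralZl//.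
apply: le_Rintegral => //.
- by have := integrableZl mX (expR (- B)) iw; exact: eq_integrable.
- exact: integrable_potential.
- move=> x Xx; rewrite expR_potentialE ler_wpM2r ?expR_ge0// ler_expR.
  by have := bf.2 _ Xx; rewrite ler_norml => /andP[].
Qed.

Lemma partition_fun_gt0 f : bounded_potential f -> 0 < partition_fun f.
Proof. by move=> /partition_fun_ge; apply: lt_le_trans; exact: expR_gt0. Qed.

Lemma gibbsE f x : gibbs f x = expR (f x) * w x / partition_fun f.
Proof. by rewrite /normalized_exp expR_potentialE. Qed.

Lemma gibbs_density f : bounded_potential f -> density_fun lam X (gibbs f).
Proof.
move=> bf; have [mf fB] := bf; have Z0 := partition_fun_gt0 bf.
have mg : measurable_fun X (fun x => expR (f x - U x)).
  by apply: measurableT_comp => //; exact: measurable_funB.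
split.
- by apply: measurable_funM => //; exact: measurable_cst.
- by move=> x _; rewrite divr_ge0 ?expR_ge0// ltW.
- under eq_integral do rewrite EFinM.
  rewrite integralZr//; last exact: integrable_potential.
  rewrite -[X in (X * _)%E]fineK;
    last exact: integrable_fin_num (integrable_potential bf).
  by rewrite -EFinM divff// lt0r_neq0.
Qed.

Lemma gibbs_le f x : bounded_potential f -> X x ->
  gibbs f x <= w x * expR (2 * B).
Proof.
move=> bf Xx; rewrite gibbsE ler_pdivrMr ?partition_fun_gt0//.
rewrite mulrC -mulrA ler_wpM2l ?expR_ge0//.
apply: le_trans (ler_wpM2l (expR_ge0 _) (partition_fun_ge bf)).
rewrite -expRD ler_expR.
by have := bf.2 _ Xx; rewrite ler_norml => /andP[]; lra.
Qed.

(* If |f - g| <= e then both the numerators and the partition functions agree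
   up to a factor expR e, so the Gibbs densities agree up to expR (2 e). *)
Lemma gibbs_ratio f g (e : R) : bounded_potential f -> bounded_potential g ->
  (forall x, X x -> `|f x - g x| <= e) ->
  forall x, X x -> gibbs f x <= expR (2 * e) * gibbs g x.
Proof.
move=> bf bg fg x Xx; rewrite !gibbsE.
have Zf := partition_fun_gt0 bf; have Zg := partition_fun_gt0 bg.
have ZZ : partition_fun g <= expR e * partition_fun f.
  rewrite -RintegralZl//; last exact: integrable_potential.
  apply: le_Rintegral => //; first exact: integrable_potential.
    have := integrableZl mX (expR e) (integrable_potential bf).
    exact: eq_integrable.
  move=> y Xy; rewrite -expRD ler_expR.
  by have := fg _ Xy; rewrite ler_norml => /andP[]; lra.
rewrite ler_pdivrMr// [leRHS](_ : _ = expR (2 * e) * expR (g x) * w x *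
  (partition_fun f / partition_fun g)); last by ring.
have fge : expR (f x) <= expR e * expR (g x).
  rewrite -expRD ler_expR.
  by have := fg _ Xx; rewrite ler_norml => /andP[]; lra.
have Zfg : expR (- e) <= partition_fun f / partition_fun g.
  by rewrite ler_pdivlMr// expRN mulrC ler_pdivrMr ?expR_gt0// mulrC.
apply: (@le_trans _ _ (expR (2 * e) * expR (g x) * w x * expR (- e))).
  rewrite mulrAC ler_wpM2r ?expR_ge0//.
  apply: (le_trans fge); rewrite mulrAC ler_wpM2r ?expR_ge0//.
  by rewrite -expRD ler_expR; lra.
by rewrite ler_wpM2l// !mulr_ge0 ?expR_ge0.
Qed.

Let gibbs_lipschitz_small f g (e : R) : bounded_potential f ->
  bounded_potential g ->
  (forall x, X x -> `|f x - g x| <= e) -> e <= 2 * B ->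
  forall x, X x ->
    `|gibbs f x - gibbs g x| <= w x * (expR (2 * B) * (2 * expR (4 * B)) * e).
Proof.
move=> bf bg fg eB x Xx.
have e0 : 0 <= e by apply: le_trans (fg _ Xx).
have gf y : X y -> `|g y - f y| <= e by move=> Xy; rewrite distrC fg.
(* Multiplying [1 - 2 * e <= expR (- (2 * e))] by [expR (2 * e)] gives
   [expR (2 * e) - 1 <= 2 * e * expR (2 * e)], and [e <= 2 * B] bounds the last exponential. *)
have k0 : expR (2 * e) - 1 <= 2 * expR (4 * B) * e.
  have : expR (- (2 * e)) >= 1 - 2 * e by exact: expR_ge1Dx.
  rewrite expRN => H.
  have E0 := expR_gt0 (2 * e).
  have : (1 - 2 * e) * expR (2 * e) <= 1.
    rewrite -[leRHS](mulVf (lt0r_neq0 E0)).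
    by rewrite ler_wpM2r// ltW.
  have : expR (2 * e) <= expR (4 * B) by rewrite ler_expR; lra.
  move=> /(ler_wpM2r e0); nra.
have main f1 g1 : bounded_potential g1 ->
    gibbs f1 x <= expR (2 * e) * gibbs g1 x ->
    gibbs f1 x - gibbs g1 x <= w x * (expR (2 * B) * (2 * expR (4 * B)) * e).
  move=> bg1 fg1.
  apply: (@le_trans _ _ (gibbs g1 x * (2 * expR (4 * B) * e))).
    apply: (@le_trans _ _ (gibbs g1 x * (expR (2 * e) - 1))); first by lra.
    by rewrite ler_wpM2l//; have [_ + _] := gibbs_density bg1; exact.
  rewrite [X in _ <= X](_ : _ = w x * expR (2 * B) *
    (2 * expR (4 * B) * e)); last by ring.
  rewrite ler_wpM2r//; first by rewrite !mulr_ge0// expR_ge0.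
  exact: gibbs_le.
rewrite ler_norml lerNl opprB; apply/andP; split; apply: main => //.
  exact: gibbs_ratio.
exact: gibbs_ratio.
Qed.

(** Two potentials bounded by [B] never differ by more than [2 * B], so [e] may be replaced by its
    minimum with [2 * B]. *)
Lemma gibbs_lipschitz f g (e : R) : bounded_potential f ->
  bounded_potential g ->
  (forall x, X x -> `|f x - g x| <= e) ->
  forall x, X x ->
    `|gibbs f x - gibbs g x| <= w x * (expR (2 * B) * (2 * expR (4 * B)) * e).
Proof.
move=> bf bg fg x Xx.
apply: (le_trans (gibbs_lipschitz_small bf bg (e := Num.min e (2 * B)) _ _ Xx)).
- move=> y Xy; rewrite le_min fg//= (le_trans (ler_normB _ _))// mulr_natl
  mulr2n.
  by rewrite lerD ?bf.2 ?bg.2.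
- by rewrite ge_min lexx orbT.
- by rewrite ler_wpM2l ?expR_ge0// ler_wpM2l ?mulr_ge0 ?expR_ge0// ge_min lexx.
Qed.

End normalized_exp_bounds.

Lemma cvg_scale_norm0 {R : realType} {T : Type} (F : set_system T)
    {FF : Filter F} (f : T -> R) (C : R) :
  f x @[x --> F] --> (0 : R) -> C * `|f x| @[x --> F] --> (0 : R).
Proof.
move=> f0; suff : C * `|f x| @[x --> F] --> C * `|0 : R|.
  by rewrite normr0 mulr0.
by apply: cvgM; [exact: cvg_cst|exact: cvg_norm].
Qed.

Lemma cvge0_le_scale_norm {R : realType} {T : Type} (F : set_system T)
    {FF : Filter F} (f : T -> R) (g : T -> \bar R) (C : R) :
  f x @[x --> F] --> (0 : R) ->
  (\forall x \near F, (0 <= g x <= (C * `|f x|)%:E)%E) ->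
  g x @[x --> F] --> 0%E.
Proof.
move=> f0 gf; apply: squeeze_cvge gf _ _ _; first exact: cvg_cst.
by apply: cvg_EFin; [exact: nearW|exact: cvg_scale_norm0].
Qed.

Lemma cvg_subr0 {R : realType} (t : R) : s - t @[s --> t] --> (0 : R).
Proof.
suff : s - t @[s --> t] --> t - t by rewrite subrr.
by apply: cvgB; [exact: cvg_id|exact: cvg_cst].
Qed.

(** * Time regularity of curves of densities *)

Section density_curves.
Context {R : realType} {d : nat} (X : set 'rV[R]_d).
Hypothesis mX : measurable X.
Local Notation lam := (lebesgue_rV R d).

Lemma TV_ge0 (P Q : prob_on X) : 0 <= TV P Q.
Proof. by apply: le_trans (TV_ge P Q measurable0). Qed.

Lemma measure_same_TV (P Q : prob_on X) : measure_same P Q -> TV P Q <= 0.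
Proof.
move=> PQ; apply: ge_sup; first exact: (has_sup_TV P Q).1.
by move=> _ [A mA <-]; rewrite PQ// subrr normr0.
Qed.

Variables (P : R -> prob_on X) (p : R -> 'rV[R]_d -> R).
Variables (g : 'rV[R]_d -> R) (C : R).
Hypothesis dP : forall t : R, 0 <= t -> is_density (P t) (p t).
Hypothesis dg : density_fun lam X g.
Hypothesis p_lip : forall s t x, 0 <= s -> 0 <= t -> X x ->
  `|p t x - p s x| <= g x * (C * `|t - s|).

Lemma lipschitz_TV_continuous : TV_continuous P.
Proof.
move=> t t0; apply: (@squeeze_cvgr _ _ _ _ (fun=> 0) (fun s => C * `|s - t|)).
- rewrite near_withinE; near=> s => s0; rewrite TV_ge0/=.
  apply: le_trans (TV_le_L1dist mX (dP s0) (dP t0)) _.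
  apply: (L1dist_le mX dg).
  + exact: is_density_density_fun (dP s0).
  + exact: is_density_density_fun (dP t0).
  + by move=> x Xx; exact: p_lip.
- exact: cvg_cst.
- by apply: cvg_within_filter; apply: cvg_scale_norm0; exact: cvg_subr0.
Unshelve. all: by end_near. Qed.

Variable v : R -> 'rV[R]_d -> R.
Hypothesis v_integrable : forall t, 0 <= t -> lam.-integrable X (EFin \o v t).
Hypothesis p_diff : forall t x, 0 <= t -> X x ->
  has_derivative_ge0 (p ^~ x) t (v t x).
Hypothesis v_lip : forall s t x, 0 <= s -> 0 <= t -> X x ->
  `|v t x - v s x| <= g x * (C * `|t - s|).

Let integral_norm_le (f : 'rV[R]_d -> R) (k : R) : measurable_fun X f ->
  (forall x, X x -> `|f x| <= g x * k) ->
  (0 <= \int[lam]_(x in X) (`|f x|%R)%:E <= k%:E)%E.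
Proof.
move=> mf fk; rewrite integral_ge0//=; last first.
have ig := density_fun_integrable dg.
have igk : lam.-integrable X (EFin \o (fun x => g x * k)).
  by have := integrableZr mX k ig; exact: eq_integrable.
have nf : lam.-integrable X (EFin \o (fun x => `|f x|)).
  apply: le_integrable igk => //.
    exact/measurable_EFinP/measurableT_comp.
  by move=> x Xx; rewrite /= normr_id lee_fin (le_trans (fk _ Xx))// ler_norm.
rewrite -[X in (X <= _)%E]fineK; last exact: integrable_fin_num nf.
by rewrite lee_fin; exact: integral_le_scale dg mf fk.
Qed.

(** A Lipschitz velocity bounds the error of the difference quotient pointwise by [g x * (C * |h|)];
    as [g] has mass one, this is an L^1 error of at most [C * |h|]. *)
Lemma lipschitz_C1_flow : C1_flow P.
Proof.
have mv t : 0 <= t -> measurable_fun X (v t).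
  by move=> t0; apply/measurable_EFinP; exact: measurable_int (v_integrable t0).
have mp t : 0 <= t -> measurable_fun X (p t) by move=> /dP[].
exists p, v; split => // t t0.
- apply: (@cvge0_le_scale_norm _ _ _ _ id _ C).
    by apply: cvg_within_filter; exact: nbhs_dnbhs.
  rewrite near_withinE; near=> h => th0.
  have hn0 : h != 0 by near: h; exact: nbhs_dnbhs_neq.
  apply: integral_norm_le.
    apply: measurable_funB; last exact: mv.
    apply: measurable_funM; first exact: measurable_cst.
    by apply: measurable_funB; exact: mp.
  move=> x Xx; rewrite mulrA.
  apply: (difference_quotient_lipschitz (fun s s0 => p_diff s0 Xx)) => //.
  by move=> s r s0 r0; rewrite -mulrA; exact: v_lip.
- apply: (@cvge0_le_scale_norm _ _ _ _ (fun s => s - t) _ C).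
    by apply: cvg_within_filter; exact: cvg_subr0.
  rewrite near_withinE; near=> s => s0.
  apply: integral_norm_le; first by apply: measurable_funB; exact: mv.
  by move=> x Xx; exact: v_lip.
Unshelve. all: by end_near. Qed.

End density_curves.

(** * The coupled system *)

Section prob_with_density.
Context {R : realType} {d : nat} (X : set 'rV[R]_d).
Hypothesis mX : measurable X.

(** Responses must be defined on arbitrary profiles, also those that are not densities; [P0] is the
    default there. On a density, the chosen measure is determined only on measurable sets. *)
Definition prob_with_density (P0 : prob_on X) (p : 'rV[R]_d -> R) : prob_on X :=
  xget P0 [set P | is_density P p].

Lemma is_density_prob_with_density P0 p : density_fun (lebesgue_rV R d) X p ->
  is_density (prob_with_density P0 p) p.
Proof.
move=> dp.
exact: (@xgetI _ P0 [set P | is_density P p] _ (is_density_prob_of_density mX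
  dp)).
Qed.

End prob_with_density.

Section two_variable_lipschitz.
Context {R : realType} {d : nat} (X Y : set 'rV[R]_d).
Hypotheses (mX : measurable X) (mY : measurable Y).
Local Notation lam := (lebesgue_rV R d).

Lemma flat_derivative_lipschitz2 (H : prob_on X -> prob_on Y -> R)
    (D1 D2 : prob_on X -> prob_on Y -> 'rV[R]_d -> R) (C1 C2 : R) :
  (forall mu, is_flat_derivative (H ^~ mu) (D1 ^~ mu)) ->
  (forall nu, is_flat_derivative (H nu) (D2 nu)) ->
  (forall nu mu x, X x -> `|D1 nu mu x| <= C1) ->
  (forall nu mu y, Y y -> `|D2 nu mu y| <= C2) ->
  forall nu nu' mu mu' p p' q q', is_density nu p -> is_density nu' p' ->
    is_density mu q -> is_density mu' q' ->
    `|H nu mu - H nu' mu'| <=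
      C1 * L1dist lam X p p' + C2 * L1dist lam Y q q'.
Proof.
move=> HD1 HD2 D1C D2C nu nu' mu mu' p p' q q' dp dp' dq dq'.
have := flat_derivative_lipschitz mX (HD1 mu) (fun P => D1C P mu) dp' dp.
have := flat_derivative_lipschitz mY (HD2 nu') (D2C nu') dq' dq.
have := ler_normD (H nu mu - H nu' mu) (H nu' mu - H nu' mu').
by rewrite addrA subrK; lra.
Qed.

End two_variable_lipschitz.

Section best_response_lipschitz.
Context {R : realType} {d : nat} (X Y Z : set 'rV[R]_d).
Hypotheses (mX : measurable X) (mY : measurable Y) (mZ : measurable Z).
Local Notation lam := (lebesgue_rV R d).
Variables (U : 'rV[R]_d -> R) (k B C : R).
Hypothesis mU : measurable_fun Z U.
Hypothesis U1 : (\int[lam]_(z in Z) (expR (- U z))%:E = 1)%E.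
Variable D : prob_on X -> prob_on Y -> 'rV[R]_d -> R.
Variables D1 D2 : prob_on X -> prob_on Y -> 'rV[R]_d -> 'rV[R]_d -> R.
Hypothesis mD : forall nu mu, measurable_fun Z (D nu mu).
Hypothesis DB : forall nu mu z, Z z -> `|D nu mu z| <= B.
Hypothesis D1P : forall mu z, Z z ->
  is_flat_derivative (fun nu => D nu mu z) (fun nu => D1 nu mu z).
Hypothesis D2P : forall nu z, Z z ->
  is_flat_derivative (fun mu => D nu mu z) (fun mu => D2 nu mu z).
Hypothesis D1C : forall nu mu z x, Z z -> X x -> `|D1 nu mu z x| <= C.
Hypothesis D2C : forall nu mu z y, Z z -> Y y -> `|D2 nu mu z y| <= C.

Local Notation response nu mu :=
  (normalized_exp Z (fun z => k * D nu mu z - U z)).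

Let potential nu mu : bounded_potential Z (`|k| * B) (fun z => k * D nu mu z).
Proof.
split; first exact: measurable_funM.
by move=> z Zz; rewrite normrM ler_wpM2l// DB.
Qed.

Lemma response_density nu mu : density_fun lam Z (response nu mu).
Proof. exact: (gibbs_density mZ mU U1 (potential nu mu)). Qed.

Lemma response_le nu mu z : Z z ->
  response nu mu z <= expR (- U z) * expR (2 * (`|k| * B)).
Proof. exact: (gibbs_le mZ mU U1 (potential nu mu)). Qed.

(** The set [Z] and the sign of [k] are free so that one estimate serves both players: [X] with
    [- (2 / sigma ^+ 2)] and [Y] with [2 / sigma ^+ 2]. *)
Lemma response_lipschitz nu nu' mu mu' p p' q q' z :
  is_density nu p -> is_density nu' p' ->
  is_density mu q -> is_density mu' q' -> Z z ->
  `|response nu mu z - response nu' mu' z| <= expR (- U z) *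
    (expR (2 * (`|k| * B)) * (2 * expR (4 * (`|k| * B))) *
     (`|k| * C) * (L1dist lam X p p' + L1dist lam Y q q')).
Proof.
move=> dp dp' dq dq' Zz;
  rewrite -[_ * _ * (_ + _)]mulrA -[`|k| * C * _]mulrA mulrDr.
apply: (gibbs_lipschitz mZ mU U1 (potential nu mu) (potential nu' mu') _ Zz).
move=> y Zy; rewrite -mulrBr normrM ler_wpM2l//.
apply: (flat_derivative_lipschitz2 mX mY (H := fun nu mu => D nu mu y)
  (D1 := fun nu mu => D1 nu mu y) (D2 := fun nu mu => D2 nu mu y)) => //.
- by move=> m; exact: D1P.
- by move=> n; exact: D2P.
- by move=> n m x Xx; exact: D1C.
- by move=> n m x Xx; exact: D2C.
Qed.

End best_response_lipschitz.

Section coupled_responses.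
Context {R : realType} {d : nat} (X Y : set 'rV[R]_d).
Hypotheses (mX : measurable X) (mY : measurable Y).
Local Notation lam := (lebesgue_rV R d).
Variables (alpha K L : R) (wX wY : 'rV[R]_d -> R).
Variables A B : prob_on X -> prob_on Y -> 'rV[R]_d -> R.
Hypothesis alpha_gt0 : 0 < alpha.
Hypothesis K_ge1 : 1 <= K.
Hypothesis L_ge0 : 0 <= L.
Hypotheses (dwX : density_fun lam X wX) (dwY : density_fun lam Y wY).
Hypothesis A_density : forall nu mu, density_fun lam X (A nu mu).
Hypothesis B_density : forall nu mu, density_fun lam Y (B nu mu).
Hypothesis A_le : forall nu mu x, X x -> A nu mu x <= wX x * K.
Hypothesis B_le : forall nu mu y, Y y -> B nu mu y <= wY y * K.
Hypothesis A_lip : forall nu nu' mu mu' p p' q q' x,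
  is_density nu p -> is_density nu' p' -> is_density mu q ->
    is_density mu' q' ->
  X x -> `|A nu mu x - A nu' mu' x| <=
    wX x * (L * (L1dist lam X p p' + L1dist lam Y q q')).
Hypothesis B_lip : forall nu nu' mu mu' p p' q q' y,
  is_density nu p -> is_density nu' p' -> is_density mu q ->
    is_density mu' q' ->
  Y y -> `|B nu mu y - B nu' mu' y| <=
    wY y * (L * (L1dist lam X p p' + L1dist lam Y q q')).
Variables (nu0 : prob_on X) (mu0 : prob_on Y).

(** For [Psi] and [Phi] in place of [A] and [B] this is [MFBR_flow] by conversion. *)
Definition coupled_flow (nu : R -> prob_on X) (mu : R -> prob_on Y) : Prop :=
  [/\ forall t, 0 <= t -> abs_cont (nu t) /\ abs_cont (mu t),
      TV_continuous nu, TV_continuous mu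
    & exists (p q : R -> 'rV[R]_d -> R),
      [/\ forall t, 0 <= t -> is_density (nu t) (p t),
          forall t, 0 <= t -> is_density (mu t) (q t),
          forall t x, 0 <= t -> X x ->
            has_derivative_ge0 (p ^~ x) t (alpha * (A (nu t) (mu t) x - p t x))
        & forall t y, 0 <= t -> Y y ->
            has_derivative_ge0 (q ^~ y) t (alpha * (B (nu t) (mu t) y - q t
              y))]].

(* The pair of flows is a single profile indexed by the two players. *)
Let Xs (b : bool) := if b then X else Y.
Let w (b : bool) := if b then wX else wY.
Let nu_of (u : bool -> 'rV[R]_d -> R) := prob_with_density nu0 (u true).
Let mu_of (u : bool -> 'rV[R]_d -> R) := prob_with_density mu0 (u false).
Let V u (b : bool) :=
  if b then A (nu_of u) (mu_of u) else B (nu_of u) (mu_of u).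

Local Notation flow := (response_flow lam Xs alpha V).
Local Notation dist := (profile_dist lam Xs).
Local Notation kappa := (response_rate bool alpha L).

Let mXs b : measurable (Xs b). Proof. by case: b. Qed.

Let dw : densities lam Xs w. Proof. by case. Qed.

Let distE u v :
  dist u v = L1dist lam X (u true) (v true) + L1dist lam Y (u false) (v false).
Proof. by rewrite /profile_dist big_bool. Qed.

Let nu_ofP u : densities lam Xs u -> is_density (nu_of u) (u true).
Proof. by move=> du; exact: is_density_prob_with_density (du true). Qed.

Let mu_ofP u : densities lam Xs u -> is_density (mu_of u) (u false).
Proof. by move=> du; exact: is_density_prob_with_density (du false). Qed.

Let V_densities u : densities lam Xs u -> densities lam Xs (V u).
Proof. by move=> _ []; [exact: A_density|exact: B_density]. Qed.

Let V_le u b x : densities lam Xs u -> Xs b x -> V u b x <= w b x * K.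
Proof. by move=> _; case: b; [exact: A_le|exact: B_le]. Qed.

Let V_lip u v b x : densities lam Xs u -> densities lam Xs v -> Xs b x ->
  `|V u b x - V v b x| <= w b x * (L * dist u v).
Proof.
move=> du dv; rewrite distE; case: b => Xx.
- by apply: A_lip => //;
  [exact: nu_ofP|exact: nu_ofP|exact: mu_ofP|exact: mu_ofP].
- by apply: B_lip => //;
  [exact: nu_ofP|exact: nu_ofP|exact: mu_ofP|exact: mu_ofP].
Qed.

Let L1dist_self Z (p : 'rV[R]_d -> R) : L1dist lam Z p p = 0.
Proof.
rewrite /L1dist (@eq_Rintegral _ _ _ _ _ (fun=> 0)); last first.
  by move=> x _; rewrite subrr normr0.
by rewrite /Rintegral integral0.
Qed.

(** The measures chosen from the densities may differ from [nu t] and [mu t] on nonmeasurable sets.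
    They share their densities, so the Lipschitz bound at distance 0 identifies the responses. *)
Let coupled_flow_profile nu mu : coupled_flow nu mu -> exists U, flow U /\
  forall t, 0 <= t ->
    is_density (nu t) (U t true) /\ is_density (mu t) (U t false).
Proof.
move=> [_ _ _ [p [q [dp dq dA dB]]]].
pose U t (b : bool) := if b then p t else q t.
have dU : density_curve lam Xs U.
  move=> t t0 [].
  - exact: is_density_density_fun (dp t t0).
  - exact: is_density_density_fun (dq t t0).
exists U; split; last by move=> t t0; split; [exact: dp|exact: dq].
split=> // b x Xx t t0; move: b Xx => [] Xx.
- have <- : A (nu t) (mu t) x = V (U t) true x; last exact: dA.
  apply/eqP; rewrite -subr_eq0 -normr_le0.
  apply: le_trans (A_lip (dp t t0) (nu_ofP (dU t t0)) (dq t t0) (mu_ofP (dU t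
    t0)) Xx) _.
  by rewrite !L1dist_self addr0 !mulr0.
- have <- : B (nu t) (mu t) x = V (U t) false x; last exact: dB.
  apply/eqP; rewrite -subr_eq0 -normr_le0.
  apply: le_trans (B_lip (dp t t0) (nu_ofP (dU t t0)) (dq t t0) (mu_ofP (dU t
    t0)) Xx) _.
  by rewrite !L1dist_self addr0 !mulr0.
Qed.

(** The factor 4 is the 2 of the L^1 stability estimate times the 2 of [L1dist_le_TV] at time 0. *)
Lemma coupled_flow_stable nu mu nu' mu' :
  coupled_flow nu mu -> coupled_flow nu' mu' -> forall t, 0 <= t ->
  TV (nu t) (nu' t) + TV (mu t) (mu' t) <=
    4 * (TV (nu 0) (nu' 0) + TV (mu 0) (mu' 0)) * expR (kappa * t).
Proof.
move=> /coupled_flow_profile[U [fU UP]] /coupled_flow_profile[U' [fU' UP']] t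
  t0.
have [nuU muU] := UP t t0; have [nuU' muU'] := UP' t t0.
apply: (@le_trans _ _ (dist (U t) (U' t))).
  rewrite distE; apply: lerD.
  - exact: TV_le_L1dist nuU nuU'.
  - exact: TV_le_L1dist muU muU'.
apply: le_trans (response_flow_stable mXs alpha_gt0 L_ge0 dw V_lip fU fU' t0) _.
apply: ler_wpM2r; first exact: expR_ge0.
rewrite (_ : 4 = 2 * 2 :> R); last by ring.
rewrite -[leRHS]mulrA; apply: ler_wpM2l => //.
have [{}nuU {}muU] := UP _ (lexx 0); have [{}nuU' {}muU'] := UP' _ (lexx 0).
rewrite distE mulrDr; apply: lerD.
- exact: L1dist_le_TV nuU nuU'.
- exact: L1dist_le_TV muU muU'.
Qed.

Lemma exists_coupled_flow : abs_cont nu0 -> abs_cont mu0 ->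
  exists (nu : R -> prob_on X) (mu : R -> prob_on Y),
    [/\ coupled_flow nu mu, measure_same (nu 0) nu0, measure_same (mu 0) mu0,
        C1_flow nu & C1_flow mu].
Proof.
move=> /abs_cont_density-/(_ mX)[p0 dp0] /abs_cont_density-/(_ mY)[q0 dq0].
have du0 : densities lam Xs (fun b => if b then p0 else q0).
  by case; [exact: is_density_density_fun dp0|exact: is_density_density_fun
    dq0].
have [U [fU U0]] := exists_response_flow mXs alpha_gt0 K_ge1 L_ge0 dw
  V_densities
  V_le V_lip du0.
have [g [C [dg lipU lipv]]] := response_flow_lipschitz mXs alpha_gt0 K_ge1
  L_ge0 dw V_densities V_le V_lip fU.
have [dU rU] := fU.
pose nu t := nu_of (U t); pose mu t := mu_of (U t).
have nuU t : 0 <= t -> is_density (nu t) (U t true).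
  by move=> t0; apply: nu_ofP; exact: dU.
have muU t : 0 <= t -> is_density (mu t) (U t false).
  by move=> t0; apply: mu_ofP; exact: dU.
have v_int b t : 0 <= t ->
    lam.-integrable (Xs b) (EFin \o velocity alpha V U t b).
  move=> t0; have dV := V_densities (dU t t0).
  have := integrableZl (mXs b) alpha (integrableB (mXs b)
    (density_fun_integrable (dV b)) (density_fun_integrable (dU t t0 b))).
  exact: eq_integrable.
exists nu, mu; split.
- split.
  + by move=> t t0; split; [exact: density_abs_cont (nuU t t0)|
                            exact: density_abs_cont (muU t t0)].
  + apply: (lipschitz_TV_continuous mX (p := fun t => U t true) nuU (dg true)).
    by move=> s t x; exact: (lipU s t true x).
  + apply: (lipschitz_TV_continuous mY (p :=
    fun t => U t false) muU (dg false)).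
    by move=> s t x; exact: (lipU s t false x).
  + exists (fun t => U t true), (fun t => U t false); split=> //.
    * by move=> t x t0 Xx; exact: (rU true x Xx t t0).
    * by move=> t y t0 Yy; exact: (rU false y Yy t t0).
- by apply: (is_density_same (nuU 0 (lexx 0))); rewrite U0.
- by apply: (is_density_same (muU 0 (lexx 0))); rewrite U0.
- apply: (lipschitz_C1_flow mX nuU (dg true) (v_int true)).
  + by move=> t x t0 Xx; exact: (rU true x Xx t t0).
  + by move=> s t x; exact: (lipv s t true x).
- apply: (lipschitz_C1_flow mY muU (dg false) (v_int false)).
  + by move=> t x t0 Xx; exact: (rU false x Xx t t0).
  + by move=> s t x; exact: (lipv s t false x).
Qed.

End coupled_responses.

Theorem proposition2p2 (R : realType) (d : nat) (X Y : set 'rV[R]_d)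
    (mX : measurable X) (mY : measurable Y)
    (Upi Urho : 'rV[R]_d -> R)
    (mUpi : measurable_fun X Upi) (mUrho : measurable_fun Y Urho)
    (intUpi : (\int[lebesgue_rV R d]_(x in X) (expR (- Upi x))%:E = 1)%E)
    (intUrho : (\int[lebesgue_rV R d]_(y in Y) (expR (- Urho y))%:E = 1)%E)
    (sigma alpha : R) (sigma_gt0 : 0 < sigma) (alpha_gt0 : 0 < alpha)
    (F : prob_on X -> prob_on Y -> R)
    (DnuF DmuF : prob_on X -> prob_on Y -> 'rV[R]_d -> R)
    (DnunuF DmunuF DmumuF DnumuF :
       prob_on X -> prob_on Y -> 'rV[R]_d -> 'rV[R]_d -> R)
    (* first order flat derivatives *)
    (DnuFP : forall mu, is_flat_derivative (F ^~ mu) (DnuF ^~ mu))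
    (DmuFP : forall nu, is_flat_derivative (F nu) (DmuF nu))
    (* second order flat derivatives *)
    (DnunuFP : forall mu x, X x ->
       is_flat_derivative (fun nu => DnuF nu mu x) (fun nu => DnunuF nu mu x))
    (DmunuFP : forall nu x, X x ->
       is_flat_derivative (fun mu => DnuF nu mu x) (fun mu => DmunuF nu mu x))
    (DmumuFP : forall nu y, Y y ->
       is_flat_derivative (fun mu => DmuF nu mu y) (fun mu => DmumuF nu mu y))
    (DnumuFP : forall mu y, Y y ->
       is_flat_derivative (fun nu => DmuF nu mu y) (fun nu => DnumuF nu mu y))
    (* (i) *)
    (bounded1 : exists Cnu Cmu : R, [/\ 0 < Cnu, 0 < Cmu &
       forall nu mu x y, X x -> Y y ->
         `|DnuF nu mu x| <= Cnu /\ `|DmuF nu mu y| <= Cmu])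
    (* (ii) *)
    (bounded2 : exists Cnunu Cmumu Cnumu Cmunu : R,
       [/\ 0 < Cnunu, 0 < Cmumu, 0 < Cnumu, 0 < Cmunu &
       forall nu mu x y x' y', X x -> Y y -> X x' -> Y y' ->
         [/\ `|DnunuF nu mu x x'| <= Cnunu, `|DmumuF nu mu y y'| <= Cmumu,
             `|DnumuF nu mu y x| <= Cnumu & `|DmunuF nu mu x y| <= Cmunu]])
    (nu0 : prob_on X) (mu0 : prob_on Y)
    (ac_nu0 : abs_cont nu0) (ac_mu0 : abs_cont mu0) :
  let solution := MFBR_flow Upi Urho sigma alpha DnuF DmuF in
  exists (nu : R -> prob_on X) (mu : R -> prob_on Y),
    [/\ [/\ solution nu mu, measure_same (nu 0) nu0 & measure_same (mu 0) mu0],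
        (* uniqueness *)
        forall (nu' : R -> prob_on X) (mu' : R -> prob_on Y),
          solution nu' mu' ->
          measure_same (nu' 0) nu0 -> measure_same (mu' 0) mu0 ->
          forall t, 0 <= t ->
            measure_same (nu' t) (nu t) /\ measure_same (mu' t) (mu t),
        (* continuous dependence on the initial condition, uniformly on
           compact time intervals *)
        forall T eps : R, 0 <= T -> 0 < eps -> exists2 delta : R, 0 < delta &
          forall (nu' : R -> prob_on X) (mu' : R -> prob_on Y),
            solution nu' mu' ->
            TV (nu' 0) nu0 < delta -> TV (mu' 0) mu0 < delta ->
            forall t, 0 <= t <= T ->
              TV (nu' t) (nu t) < eps /\ TV (mu' t) (mu t) < eps,
        C1_flow nu
      & C1_flow mu].
Proof.
have [Cnu [Cmu [Cnu0 Cmu0 bound1]]] := bounded1.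
have [Cnunu [Cmumu [Cnumu [Cmunu [c1 c2 c3 c4 bound2]]]]] := bounded2.
(* Hypotheses (i) and (ii) bound the derivatives for points of [X] and [Y] jointly, so extracting a
   bound in one variable takes a point of the other set; the unit mass of the reference density
   provides it. *)
have nonempty (Z : set 'rV[R]_d) (U : 'rV[R]_d -> R) :
    (\int[lebesgue_rV R d]_(z in Z) (expR (- U z))%:E = 1)%E -> exists z, Z z.
  move=> ZU; have [//|/nonemptyPn Z0] := pselect (Z !=set0).
  by move: ZU; rewrite Z0 integral_set0 => /eqP; rewrite eq_sym onee_eq0.
have [x0 Xx0] := nonempty _ _ intUpi; have [y0 Yy0] := nonempty _ _ intUrho.
pose k : R := 2 / sigma ^+ 2.
have k0 : 0 <= k by rewrite divr_ge0// exprn_ge0 ?ltW.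
pose B := Cnu + Cmu.
pose lam := lebesgue_rV R d.
pose K := expR (2 * (k * B)).
pose CC := Cnunu + Cmumu + Cnumu + Cmunu.
pose L := K * (2 * expR (4 * (k * B))) * (k * CC).
have mDnu nu mu : measurable_fun X (DnuF nu mu).
  exact: (is_flat_derivative_measurable mX nu (DnuFP mu)).
have mDmu nu mu : measurable_fun Y (DmuF nu mu).
  exact: (is_flat_derivative_measurable mY mu (DmuFP nu)).
have DnuB nu mu x : X x -> `|DnuF nu mu x| <= B.
  move=> Xx; apply: le_trans (bound1 nu mu x y0 Xx Yy0).1 _.
  by rewrite lerDl ltW.
have DmuB nu mu y : Y y -> `|DmuF nu mu y| <= B.
  move=> Yy; apply: le_trans (bound1 nu mu x0 y Xx0 Yy).2 _.
  by rewrite lerDr ltW.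
have DnunuB nu mu x x' : X x -> X x' -> `|DnunuF nu mu x x'| <= CC.
  move=> Xx Xx'; have [+ _ _ _] := bound2 nu mu x y0 x' y0 Xx Yy0 Xx' Yy0.
  by rewrite /CC; lra.
have DmumuB nu mu y y' : Y y -> Y y' -> `|DmumuF nu mu y y'| <= CC.
  move=> Yy Yy'; have [_ + _ _] := bound2 nu mu x0 y x0 y' Xx0 Yy Xx0 Yy'.
  by rewrite /CC; lra.
have DnumuB nu mu y x : Y y -> X x -> `|DnumuF nu mu y x| <= CC.
  move=> Yy Xx; have [_ _ + _] := bound2 nu mu x y x y Xx Yy Xx Yy.
  by rewrite /CC; lra.
have DmunuB nu mu x y : X x -> Y y -> `|DmunuF nu mu x y| <= CC.
  move=> Xx Yy; have [_ _ _] := bound2 nu mu x y x y Xx Yy Xx Yy.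
  by rewrite /CC; lra.
have normNk : `|- k| = k by rewrite normrN ger0_norm.
have normk : `|k| = k by rewrite ger0_norm.
pose PsiF := Psi Upi sigma DnuF; pose PhiF := Phi Urho sigma DmuF.
have Psi_density nu mu : density_fun lam X (PsiF nu mu).
  exact: (response_density mX (- k) mUpi intUpi mDnu DnuB).
have Phi_density nu mu : density_fun lam Y (PhiF nu mu).
  exact: (response_density mY k mUrho intUrho mDmu DmuB).
have Psi_le nu mu x : X x -> PsiF nu mu x <= expR (- Upi x) * K.
  by move=> Xx; have := response_le mX (- k) mUpi intUpi mDnu DnuB nu mu Xx;
    rewrite normNk.
have Phi_le nu mu y : Y y -> PhiF nu mu y <= expR (- Urho y) * K.
  by move=> Yy; have := response_le mY k mUrho intUrho mDmu DmuB nu mu Yy;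
    rewrite normk.
have Psi_lip nu nu' mu mu' p p' q q' x : is_density nu p -> is_density nu' p' ->
    is_density mu q -> is_density mu' q' -> X x ->
    `|PsiF nu mu x - PsiF nu' mu' x| <=
      expR (- Upi x) * (L * (L1dist lam X p p' + L1dist lam Y q q')).
  move=> dp dp' dq dq' Xx.
  have := response_lipschitz mX mY mX (- k) mUpi intUpi mDnu DnuB
    DnunuFP DmunuFP DnunuB DmunuB dp dp' dq dq' Xx.
  by rewrite normNk.
have Phi_lip nu nu' mu mu' p p' q q' y : is_density nu p -> is_density nu' p' ->
    is_density mu q -> is_density mu' q' -> Y y ->
    `|PhiF nu mu y - PhiF nu' mu' y| <=
      expR (- Urho y) * (L * (L1dist lam X p p' + L1dist lam Y q q')).
  move=> dp dp' dq dq' Yy.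
  have := response_lipschitz mX mY mY k mUrho intUrho mDmu DmuB
    DnumuFP DmumuFP DnumuB DmumuB dp dp' dq dq' Yy.
  by rewrite normk.
have B0 : 0 <= B by rewrite /B; lra.
have K1 : 1 <= K by rewrite -expR0 ler_expR mulr_ge0// mulr_ge0.
have L0 : 0 <= L.
  have CC0 : 0 <= CC by rewrite /CC; lra.
  by apply: mulr_ge0; apply: mulr_ge0 => //; rewrite ?mulr_ge0 ?expR_ge0.
have dwX : density_fun lam X (fun x => expR (- Upi x)).
  by split=> //; apply: measurableT_comp => //; exact: measurable_funN.
have dwY : density_fun lam Y (fun y => expR (- Urho y)).
  by split=> //; apply: measurableT_comp => //; exact: measurable_funN.
have stable := coupled_flow_stable mX mY alpha_gt0 L0 dwX dwY Psi_lip Phi_lip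
  nu0 mu0.
have [nu [mu [flow nu0E mu0E C1nu C1mu]]] :=
  exists_coupled_flow mX mY alpha_gt0 K1 L0
  dwX dwY Psi_density Phi_density Psi_le Phi_le Psi_lip Phi_lip ac_nu0 ac_mu0.
(* The initial values agree with [nu0] and [mu0] only on measurable sets, and the total variation
   sees no others. *)
have TV0 (Z : set 'rV[R]_d) (P P' Q : prob_on Z) : measure_same P' Q ->
    TV P P' = TV P Q.
  move=> PQ; rewrite /TV; congr (sup _); apply/seteqP.
  by split=> _ [C mC <-]; exists C => //; rewrite PQ.
exists nu, mu; split=> //.
- move=> nu' mu' flow' nu'0 mu'0 t t0.
  have := stable _ _ _ _ flow' flow t t0.
  rewrite (TV0 _ _ _ _ nu0E) (TV0 _ _ _ _ mu0E).
  have := measure_same_TV nu'0; have := measure_same_TV mu'0.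
  have := TV_ge0 (nu' t) (nu t); have := TV_ge0 (mu' t) (mu t).
  move=> T1 T2 T3 T4 T5.
  have T6 : TV (nu' t) (nu t) + TV (mu' t) (mu t) <= 0.
    apply: le_trans T5 _; rewrite mulrC pmulr_rle0 ?expR_gt0//; lra.
  by split; apply: TV_le0_same; lra.
- move=> T eps T0 eps0.
  set kappa := response_rate bool alpha L in stable.
  have kappa0 : 0 <= kappa by exact: response_rate_ge0.
  (* Here 8 is the stability constant 4 times the two initial distances, each below [delta]. *)
  exists (eps / (8 * expR (kappa * T)));
    first by rewrite divr_gt0// mulr_gt0// expR_gt0.
  move=> nu' mu' flow' nu'0 mu'0 t /andP[t0 tT].
  have := stable _ _ _ _ flow' flow t t0.
  rewrite (TV0 _ _ _ _ nu0E) (TV0 _ _ _ _ mu0E).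
  set S := TV _ nu0 + TV _ mu0 => H.
  have S0 : 0 <= S by rewrite addr_ge0// TV_ge0.
  have EtT : expR (kappa * t) <= expR (kappa * T).
    by rewrite ler_expR ler_wpM2l.
  have SE : 4 * S * expR (kappa * T) < eps.
    rewrite -ltr_pdivlMr ?expR_gt0//.
    have : 8 * (eps / (8 * expR (kappa * T))) = eps / expR (kappa * T).
      by field; exact: lt0r_neq0 (expR_gt0 _).
    by rewrite /S; lra.
  have H2 : 4 * S * expR (kappa * t) <= 4 * S * expR (kappa * T).
    by rewrite ler_wpM2l// mulr_ge0.
  have := TV_ge0 (nu' t) (nu t); have := TV_ge0 (mu' t) (mu t).
  by move=> ? ?; split; lra.
Qed.
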